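(* Let $G$ be a finite simple graph with maximum degree $\Delta(G)\le 4$. If $\mathrm{mad}(G)<\frac{8}{3}$, then $\chi_i'(G)\le 7$.
   Context: All graphs are finite, simple and undirected. The maximum average degree of $G$ is $\mathrm{mad}(G)=\max\{2|E(H)|/|V(H)| : H\subseteq G\}$, the maximum taken over nonempty subgraphs $H$. Two edges $e,e'$ are at distance two if they are distinct, share no endpoint, and some edge of $G$ shares an endpoint with each of them (i.e. an endpoint of $e$ is adjacent to an endpoint of $e'$). An injective $k$-edge-coloring of $G$ is a map $\phi:E(G)\to\{1,\dots,k\}$ such that $\phi(e)\ne\phi(e')$ whenever $e,e'$ are at distance two or $e,e'$ are two edges of a common triangle. The injective chromatic index $\chi_i'(G)$ is the least $k$ for which $G$ has an injective $k$-edge-coloring. *)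

(* Defs.v *)
From mathcomp Require Import all_boot all_order all_algebra.

Set Implicit Arguments.
Unset Strict Implicit.
Unset Printing Implicit Defensive.

Import Order.TTheory GRing.Theory Num.Theory.

Record sgraph := SGraph {
  vertex :> finType;
  adj : rel vertex;
  adj_sym : symmetric adj;
  adj_irrefl : irreflexive adj }.

Section SimpleGraph.
Variable G : sgraph.

Definition edges : {set {set G}} :=
  [set [set p.1; p.2] | p : G * G & adj p.1 p.2].

Definition edge := {e : {set G} | e \in edges}.

Definition degree (x : G) : nat := #|[set y | adj x y]|.

Definition max_degree : nat := \max_(x : G) degree x.

(* A subgraph, not necessarily induced, is given by its vertex set and its
   edge set. *)
Definition nonempty_subgraph (H : {set G} * {set {set G}}) : bool :=
  [&& H.1 != set0, H.2 \subset edges & [forall e in H.2, e \subset H.1]].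

(* All the ratios are nonnegative, so starting the maximum at 0 matters only
   for the graph with no vertices, where it gives mad = 0. *)
Definition mad : rat :=
  (\big[Num.max/0]_(H : {set G} * {set {set G}} | nonempty_subgraph H)
     ((2 * #|H.2|)%:R / #|H.1|%:R))%R.

Definition distance_two (e e' : {set G}) : bool :=
  [&& e != e', [disjoint e & e'] &
      [exists f in edges, ~~ [disjoint f & e] && ~~ [disjoint f & e']]].

Definition triangle (W : {set G}) : bool :=
  (#|W| == 3) && [forall x in W, forall y in W, (x != y) ==> adj x y].

Definition in_common_triangle (e e' : {set G}) : bool :=
  (e != e') && [exists W : {set G}, [&& triangle W, e \subset W & e' \subset W]].

Definition injective_edge_coloring (k : nat) (phi : {ffun edge -> 'I_k}) : bool :=
  [forall e : edge, forall e' : edge,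
     distance_two (val e) (val e') || in_common_triangle (val e) (val e')
     ==> (phi e != phi e')].

Definition injectively_edge_colorable (k : nat) : bool :=
  [exists phi : {ffun edge -> 'I_k}, injective_edge_coloring phi].

Lemma injectively_edge_colorable_exists :
  exists k, injectively_edge_colorable k.
Proof.
exists #|{: edge}|; apply/existsP; exists [ffun e => enum_rank e].
apply/forallP => e; apply/forallP => e'; apply/implyP => h.
rewrite !ffunE (inj_eq enum_rank_inj) -(inj_eq val_inj).
by case/orP: h => /andP[].
Qed.

Definition injective_chromatic_index : nat :=
  ex_minn injectively_edge_colorable_exists.

End SimpleGraph.

(* Main.v *)
Require Import Defs.
From mathcomp Require Import all_boot all_order all_algebra.
From mathcomp Require Import zify.

(* Take a minimal set K of edges whose conflict graph is not 7-colorable, and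
   the subgraph g induced on the vertices covered by K.  Every edge of K has at
   least 7 conflicts in K, and every vertex of g meets K: this replaces
   the deletion of a vertex from a minimal counterexample.  The number of
   conflicts of uv is bounded by counting, for each other neighbor x of u or v,
   the edges of K at x that avoid u or v (the load of x on u or v).

   Leaves of g are adjacent only to 4-vertices that have no other leaf, so
   discharging is done on the subgraph of the vertices of degree at least 2, with
   charge deg - 8/3.  A 2-vertex normally takes 1/3 from both neighbors; it takes
   2/3 from w when its other neighbor u is weak: then w carries loads adding up
   to at least 6.  3-vertices that pay too much recover 1/6 or 1/3 from their
   neighbors of degree 4.  Comparing loads with payments shows that every
   vertex can pay, except for two configurations around a 4-vertex with a leaf
   and two 3-vertices; these are recolored by hand. *)

Set Implicit Arguments.
Unset Strict Implicit.
Unset Printing Implicit Defensive.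

(** * Critical sets of a conflict relation *)

Lemma pick_other (I : finType) (L : {set I}) (a : I) : 1 < #|L| -> exists2 x, x \in L & x != a.
Proof.
move=> h; have /card_gt0P[x] : 0 < #|L :\ a| by have := cardsD1 a L; case: (a \in L) => /=; lia.
by rewrite !inE => /andP[]; exists x.
Qed.

(* L1, M1, L2, M2 are the lists of the consecutive vertices of a 4-cycle. *)
Lemma list_coloring_C4 (I : finType) (L1 L2 M1 M2 : {set I}) :
  1 < #|L1| -> 1 < #|L2| -> 1 < #|M1| -> 1 < #|M2| ->
  exists x y u v, [/\ [/\ x \in L1, y \in L2, u \in M1 & v \in M2],
    x != u, x != v, y != u & y != v].
Proof.
move=> l1 l2 m1 m2.
(* A common color of [L1] and [L2] serves both vertices, and each of [M1], [M2] contains another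
   color. *)
have [/set0Pn[x]|/negPn/eqP disj] := boolP (L1 :&: L2 != set0).
  rewrite inE => /andP[x1 x2].
  have [u uM ux] := pick_other x m1; have [v vM vx] := pick_other x m2.
  by exists x, x, u, v; rewrite ![x == _]eq_sym.
have nd x y : x \in L1 -> y \in L2 -> x != y.
  move=> x1 y2; apply/eqP => xy; have : x \in L1 :&: L2 by rewrite inE x1 xy y2.
  by rewrite disj inE.
have pickM (M : {set I}) x y : (exists2 u, u \in M & (x != u) && (y != u)) \/ M \subset [set x; y].
  case: (boolP (M \subset [set x; y])) => [|/subsetPn[u uM]]; first by right.
  rewrite !inE negb_or => /andP[ux uy]; left; exists u => //.
  by rewrite ![_ == u]eq_sym ux.
have eqM (M : {set I}) x y : 1 < #|M| -> M \subset [set x; y] -> x != y -> M = [set x; y].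
  by move=> hM sM xy; apply/eqP; rewrite eqEcard sM cards2 xy.
have [x1 [x2 [x1L x2L x12]]] : exists x1 x2, [/\ x1 \in L1, x2 \in L1 & x1 != x2].
  by case/card_gt1P: l1 => a [b [? ? ?]]; exists a, b.
have [y1 [y2 [y1L y2L y12]]] : exists x1 x2, [/\ x1 \in L2, x2 \in L2 & x1 != x2].
  by case/card_gt1P: l2 => a [b [? ? ?]]; exists a, b.
have bad x y : x \in L1 -> y \in L2 ->
   (exists x y u v, [/\ [/\ x \in L1, y \in L2, u \in M1 & v \in M2],
    x != u, x != v, y != u & y != v]) \/ (M1 = [set x; y] \/ M2 = [set x; y]).
  move=> xL yL; have [[u uM /andP[xu yu]]|s1] := pickM M1 x y; last first.
    by right; left; apply: eqM; rewrite ?nd.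
  have [[v vM /andP[xv yv]]|s2] := pickM M2 x y; last first.
    by right; right; apply: eqM; rewrite ?nd.
  by left; exists x, y, u, v.
have diff x y x' y' : x \in L1 -> y \in L2 -> x' \in L1 -> y' \in L2 ->
   [set x; y] = [set x'; y'] -> x = x' /\ y = y'.
  move=> xL yL x'L y'L /setP h; split.
    by have := h x; rewrite !inE eqxx (negPf (nd x y' _ _)) // orbF => /esym/eqP.
  by have := h y; rewrite !inE eqxx orbT [y == x']eq_sym (negPf (nd x' y _ _)) // => /esym/eqP.
(* A pair of choices fails only if, as a set, it is [M1] or [M2]. The lists [L1] and [L2] being
   disjoint, these three pairs are distinct sets, too many for two lists. *)
have [//|b11] := bad _ _ x1L y1L; have [//|b12] := bad _ _ x1L y2L.
have [//|b21] := bad _ _ x2L y1L.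
have n1 : [set x1; y1] <> [set x1; y2].
  by case/diff => // _ y_eq; rewrite y_eq eqxx in y12.
have n2 : [set x1; y1] <> [set x2; y1].
  by case/diff => // x_eq _; rewrite x_eq eqxx in x12.
have n3 : [set x1; y2] <> [set x2; y1].
  by case/diff => // x_eq _; rewrite x_eq eqxx in x12.
by exfalso; case: b11 b12 b21 => ? [] ? [] ?; congruence.
Qed.

Section CriticalSets.
Variables (E : finType) (r : rel E) (n : nat).
Hypotheses (r_sym : symmetric r) (r_irr : irreflexive r).
Implicit Types (A K D : {set E}) (c : {ffun E -> 'I_n}).

Definition proper_coloring (A : {set E}) (c : {ffun E -> 'I_n}) : bool :=
  [forall e in A, forall f in A, r e f ==> (c e != c f)].

Definition colorable (A : {set E}) : bool := [exists c, proper_coloring A c].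

Lemma proper_coloringP (A : {set E}) (c : {ffun E -> 'I_n}) :
  reflect {in A &, forall e f, r e f -> c e != c f} (proper_coloring A c).
Proof.
apply: (iffP forall_inP) => [h e f eA fA ref | h e eA].
  by have /forall_inP/(_ f fA)/implyP := h e eA; apply.
by apply/forall_inP => f fA; apply/implyP; apply: h.
Qed.

Definition conflicts (K : {set E}) (e : E) : {set E} := [set f in K | r e f].

(* The colors [e] may take when [c] is kept outside [D]. *)
Definition available (K : {set E}) (c : {ffun E -> 'I_n}) (D : {set E}) (e : E) :
  {set 'I_n} := ~: (c @: (conflicts K e :\: D)).

Lemma availableP K c D e i :
  reflect (forall f, f \in K -> r e f -> f \notin D -> c f != i)
          (i \in available K c D e).
Proof.
rewrite inE; apply: (iffP idP) => [h f fK ref fD | h].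
  apply: contra h => /eqP <-; apply: imset_f.
  by rewrite !inE fD fK ref.
apply/imsetP => -[f]; rewrite !inE => /and3P[fD fK ref] cf.
by have := h f fK ref fD; rewrite cf eqxx.
Qed.

Lemma card_setC_ord m (X : {set 'I_m}) : #|~: X| = m - #|X|.
Proof. by have := cardsC X; rewrite card_ord; lia. Qed.

(** Only conflicts outside [D] block a color, and there are at most [n - #|D|] of them. *)
Lemma card_available K c (D : {set E}) e :
  #|conflicts K e| <= n -> D \subset conflicts K e ->
  #|D| <= #|available K c D e|.
Proof.
move=> le_n sD; have := leq_imset_card c (conflicts K e :\: D).
rewrite card_setC_ord.
have := cardsD (conflicts K e) D; rewrite (setIidPr sD).
have := subset_leq_card sD; move: le_n.
move: #|_ :\: _| #|[set _ | _ in _]| #|D| #|conflicts _ _| => a1 a2 a3 a4. lia.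
Qed.

Lemma available_neq0 K c (D : {set E}) e d :
  #|conflicts K e| <= n -> d \in D -> D \subset conflicts K e ->
  exists i, i \in available K c D e.
Proof.
move=> le_n dD sD; apply/set0Pn; rewrite -card_gt0.
by apply: leq_trans (card_available _ le_n sD); apply/card_gt0P; exists d.
Qed.

Lemma proper_recolor (K D : {set E}) (c c' : {ffun E -> 'I_n}) :
  proper_coloring (K :\: D) c -> {in ~: D, c' =1 c} ->
  {in D & K, forall d f, r d f -> c' d != c' f} -> proper_coloring K c'.
Proof.
move=> /proper_coloringP cP c'c c'D; apply/proper_coloringP => e f eK fK ref.
case: (boolP (e \in D)) => eD; first exact: c'D.
case: (boolP (f \in D)) => fD.
  by rewrite eq_sym; apply: c'D => //; rewrite r_sym.
by rewrite !c'c ?inE //; apply: cP; rewrite // !inE ?eD ?fD.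
Qed.

Definition critical := minset (fun A => ~~ colorable A).

Variable K : {set E}.
Hypothesis K_crit : critical K.

Lemma critical_not_proper c : ~~ proper_coloring K c.
Proof.
by apply: contra (minsetp K_crit) => cP; apply/existsP; exists c.
Qed.

Lemma critical_proper (D : {set E}) e : e \in K -> e \in D ->
  exists c, proper_coloring (K :\: D) c.
Proof.
move=> eK eD; apply/existsP; apply: contraT => hD.
have eq_K := minsetinf K_crit hD (subsetDl K D).
by move: eK; rewrite -eq_K inE eD.
Qed.

(** With fewer than [n] conflicts, a coloring of the rest of [K] would extend greedily to [e]. *)
Lemma critical_degree e : e \in K -> n <= #|conflicts K e|.
Proof.
move=> eK; rewrite leqNgt; apply/negP => lt_n.
have [c cP] := critical_proper eK (set11 e).
have [i iP] : exists i, i \in available K c set0 e.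
  apply/set0Pn; rewrite -card_gt0; have := leq_imset_card c (conflicts K e :\: set0).
  by rewrite card_setC_ord setD0 subn_gt0 => h; apply: leq_ltn_trans h lt_n.
case/negP: (critical_not_proper [ffun f => if f == e then i else c f]).
apply: (proper_recolor cP) => [f|d f].
  by rewrite !inE ffunE => /negPf->.
rewrite inE => /eqP-> fK ref; rewrite !ffunE eqxx.
have fe : f != e by apply: contraTneq ref => ->; rewrite r_irr.
by rewrite (negPf fe) eq_sym; move/availableP: iP; apply; rewrite ?inE.
Qed.


Lemma r_neq e f : r e f -> e != f.
Proof. by apply: contraTneq => ->; rewrite r_irr. Qed.

(** Uncoloring an induced 4-cycle [a1 b1 a2 b2] of the conflict relation leaves at least two colors
    for each of its elements, and a 4-cycle can be colored from lists of size 2. *)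
Lemma critical_no_C4 a1 a2 b1 b2 :
  {in [set a1; a2; b1; b2], forall e, e \in K /\ #|conflicts K e| <= n} ->
  a1 != a2 -> b1 != b2 -> ~~ r a1 a2 -> ~~ r b1 b2 ->
  r a1 b1 -> r a1 b2 -> r a2 b1 -> r a2 b2 -> False.
Proof.
move=> low a12 b12 ra rb r11 r12 r21 r22.
set D := [set a1; a2; b1; b2] in low.
have [a1D a2D b1D b2D] : [/\ a1 \in D, a2 \in D, b1 \in D & b2 \in D].
  by rewrite !inE !eqxx ?orbT.
have [a1K a1n] := low _ a1D; have [a2K a2n] := low _ a2D.
have [b1K b1n] := low _ b1D; have [b2K b2n] := low _ b2D.
have [c cP] := critical_proper a1K a1D.
have big_a (a : E) : a \in D -> r a b1 -> r a b2 -> 1 < #|available K c [set b1; b2] a|.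
  move=> /low[_ an] h1 h2; apply: leq_trans (card_available c an _).
    by rewrite cards2 b12.
  by apply/subsetP => x /set2P[]->; rewrite inE ?b1K ?b2K.
have big_b (b : E) : b \in D -> r a1 b -> r a2 b -> 1 < #|available K c [set a1; a2] b|.
  move=> /low[_ bn] h1 h2; apply: leq_trans (card_available c bn _).
    by rewrite cards2 a12.
  by apply/subsetP => x /set2P[]->; rewrite inE r_sym ?a1K ?a2K.
have [x [y [u [v [[xL yL uL vL] xu xv yu yv]]]]] :=
  list_coloring_C4 (big_a a1 a1D r11 r12) (big_a a2 a2D r21 r22)
    (big_b b1 b1D r11 r21) (big_b b2 b2D r12 r22).
pose c' := [ffun e => if e == a1 then x else if e == a2 then y
  else if e == b1 then u else if e == b2 then v else c e].
have [c1 c2 c3 c4] : [/\ c' a1 = x, c' a2 = y, c' b1 = u & c' b2 = v].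
  rewrite !ffunE !eqxx [a2 == a1]eq_sym [b2 == b1]eq_sym (negPf a12) (negPf b12).
  by rewrite !(eq_sym _ a1) !(eq_sym _ a2) !(negPf (r_neq _)).
have c0 : {in ~: D, c' =1 c}.
  move=> f; rewrite !inE !negb_or -!andbA ffunE.
  by move=> /and4P[/negPf-> /negPf-> /negPf-> /negPf->].
case/negP: (critical_not_proper c'); apply: (proper_recolor cP c0).
have off f e i D' : f \in K -> r e f -> f \notin D -> D' \subset D ->
    i \in available K c D' e -> i != c' f.
  move=> fK ref fD sD /availableP iP; rewrite c0 ?in_setC // eq_sym; apply: iP => //.
  by apply: contra fD; apply: (subsetP sD).
have sb : [set b1; b2] \subset D by rewrite subUset !sub1set b1D b2D.
have sa : [set a1; a2] \subset D by rewrite subUset !sub1set a1D a2D.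
move=> d f dD fK; case: (boolP (f \in D)) => fD rdf.
  have ra' : ~~ r a2 a1 by rewrite r_sym.
  have rb' : ~~ r b2 b1 by rewrite r_sym.
  move: dD fD rdf; rewrite !inE -!orbA => /or4P[] /eqP-> /or4P[] /eqP->;
    rewrite ?c1 ?c2 ?c3 ?c4 ?r_irr ?(negPf ra) ?(negPf rb) ?(negPf ra') ?(negPf rb') //;
    by rewrite eq_sym.
move: dD; rewrite !inE -!orbA => /or4P[] /eqP def_d; rewrite def_d ?c1 ?c2 ?c3 ?c4 in rdf *;
  by [exact: (off _ _ _ _ fK rdf fD sb) | exact: (off _ _ _ _ fK rdf fD sa)].
Qed.

(* Uncolor p, y, v, and let i be a free color of y.  If i is not available for v,
   then y gets i and p, v are colored greedily; otherwise y, p and t all get i,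
   after moving s1 and s2 away from i. *)
Lemma critical_no_fork p y v t s1 s2 :
  {in [set p; y; v; s1; s2], forall e, e \in K /\ #|conflicts K e| <= n} ->
  [/\ p != y, p != t & s1 != s2] -> t \in K ->
  [/\ r p v, r y v & {in [set s1; s2], forall s, r s p /\ r s t}] ->
  [/\ ~~ r p y, ~~ r t p, ~~ r t y, ~~ r t v & ~~ r s1 s2] ->
  {in [set s1; s2], forall s, ~~ r s v /\ ~~ r s y} ->
  {in K, forall f, r p f -> f \notin [set s1; s2] -> r y f} ->
  {in K, forall f, r t f -> f \notin [set s1; s2] -> r y f || r v f} -> False.
Proof.
move=> low [py pt s12] tK [rpv ryv rs] [npy ntp nty ntv ns12] ns Np Nt.
have [[pK p_n] [yK y_n] [vK v_n]] :
  [/\ p \in K /\ #|conflicts K p| <= n, y \in K /\ #|conflicts K y| <= n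
     & v \in K /\ #|conflicts K v| <= n].
  by split; apply: low; rewrite !inE eqxx ?orbT.
have lows s : s \in [set s1; s2] -> s \in K /\ #|conflicts K s| <= n.
  by move=> /set2P[]->; apply: low; rewrite !inE eqxx ?orbT.
have [c cP] := critical_proper pK (set11 p).
have v_conf a : r a v -> [set v] \subset conflicts K a.
  by move=> rav; rewrite sub1set inE vK.
have [i iY] := available_neq0 c y_n (set11 v) (v_conf y ryv).
have [j jP] := available_neq0 c p_n (set11 v) (v_conf p rpv).
have Lv : 1 < #|available K c [set p; y] v|.
  apply: leq_trans (card_available c v_n _); first by rewrite cards2 py.
  by apply/subsetP => f /set2P[]->; rewrite inE r_sym ?pK ?yK.
have nE a b : r a b -> (a == b = false) * (b == a = false).
  by move=> /r_neq ab; split; apply/negbTE; rewrite // eq_sym.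
have [iv|niv] := boolP (i \in available K c [set p; y] v); last first.
  have [k kV kj] := pick_other j Lv.
  have ki : k != i by apply: contraNneq niv => <-.
  pose c' := [ffun e => if e == p then j else if e == y then i else
     if e == v then k else c e].
  have [cp cy cv] : [/\ c' p = j, c' y = i & c' v = k].
    rewrite !ffunE !eqxx [y == p]eq_sym (negPf py).
    by rewrite !(eq_sym v) (nE _ _ rpv) (nE _ _ ryv).
  case/negP: (critical_not_proper c').
  have sD : K :\: [set p; y; v] \subset K :\: [set p].
    by apply: setDS; rewrite -!setUA subsetUl.
  have cD : proper_coloring (K :\: [set p; y; v]) c.
    apply/proper_coloringP => e f /(subsetP sD) eK /(subsetP sD) fK; move/proper_coloringP: cP.
    exact.
  have c0 : {in ~: [set p; y; v], c' =1 c}.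
    move=> f; rewrite !inE !negb_or -!andbA ffunE.
    by move=> /and3P[/negPf-> /negPf-> /negPf->].
  apply: (proper_recolor cD c0) => d f; rewrite !inE -!orbA => dD fK.
  case: (boolP (f \in [set p; y; v])) => [|fD].
    have nyp : ~~ r y p by rewrite r_sym.
    by move: dD; rewrite !inE -!orbA => /or3P[] /eqP-> /or3P[] /eqP->;
      rewrite ?cp ?cy ?cv ?r_irr ?(negPf npy) ?(negPf nyp) // eq_sym.
  rewrite (c0 f) ?in_setC //; move: fD; rewrite !inE !negb_or -andbA => /and3P[fp fy fv] rdf.
  rewrite eq_sym; move: dD rdf => /or3P[] /eqP->; rewrite ?cp ?cy ?cv => rdf.
  - by move/availableP: jP; apply; rewrite ?inE.
  - by move/availableP: iY; apply; rewrite ?inE.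
  - by move/availableP: kV; apply; rewrite ?inE ?negb_or ?fp.
have [m mV mi] := pick_other i Lv.
(* Both [p] and [t] conflict with [s] and give up their colors, so [s] has two colors to choose
   from, one of them different from [i]. *)
have Ls s : s \in [set s1; s2] -> exists2 k, k \in available K c [set p; t] s & k != i.
  move=> sS; have [sK s_n] := lows s sS; have [rsp rst] := rs s sS.
  apply: pick_other; apply: leq_trans (card_available c s_n _); first by rewrite cards2 pt.
  by apply/subsetP => f /set2P[]->; rewrite inE ?pK ?tK.
have [k1 k1V k1i] := Ls s1 (set21 _ _); have [k2 k2V k2i] := Ls s2 (set22 _ _).
have [r1p r1t] := rs s1 (set21 _ _); have [r2p r2t] := rs s2 (set22 _ _).
have [n1v n1y] := ns s1 (set21 _ _); have [n2v n2y] := ns s2 (set22 _ _).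
pose c' := [ffun e => if e \in [set p; y; t] then i else if e == v then m else
   if e == s1 then k1 else if e == s2 then k2 else c e].
have nvt : v != t by apply: contraNneq n1v => ->.
have n1y' : s1 != y by apply: contraNneq npy => <-; rewrite r_sym.
have n2y' : s2 != y by apply: contraNneq npy => <-; rewrite r_sym.
have n1v' : s1 != v by apply: contraNneq ntv => <-; rewrite r_sym.
have n2v' : s2 != v by apply: contraNneq ntv => <-; rewrite r_sym.
have [cv c1 c2] : [/\ c' v = m, c' s1 = k1 & c' s2 = k2].
  rewrite !ffunE !inE !eqxx (negPf n1v') (negPf n2v') (negPf n1y') (negPf n2y') (negPf nvt).
  rewrite (nE _ _ r1p) (nE _ _ r2p) (nE _ _ r1t) (nE _ _ r2t) (nE _ _ rpv) (nE _ _ ryv).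
  by rewrite [s2 == s1]eq_sym (negPf s12).
have cpyt f : f \in [set p; y; t] -> c' f = i by rewrite ffunE => ->.
pose D := [set p; y; t] :|: [set v] :|: [set s1; s2].
have c0 f : f \notin D -> c' f = c f.
  rewrite ffunE !in_setU !negb_or !in_set1 -!andbA.
  by move=> /and5P[/negPf-> /negPf-> /negPf-> /negPf-> /andP[/negPf-> /negPf->]].
case/negP: (critical_not_proper c').
have sD : K :\: D \subset K :\: [set p].
  by apply: setDS; rewrite /D -!setUA subsetUl.
have cD : proper_coloring (K :\: D) c.
  apply/proper_coloringP => e f /(subsetP sD) eK /(subsetP sD) fK; move/proper_coloringP: cP.
  exact.
have c0' : {in ~: D, c' =1 c} by move=> f; rewrite in_setC; apply: c0.
apply: (proper_recolor cD c0') => d f dD fK rdf.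
(* Outside [D], the last two hypotheses turn every conflict of [p] or [t] into a conflict of [y] or
   [v], where the color [i] does not occur. *)
have pyt_case e g : e \in [set p; y; t] -> g \in K -> r e g -> c' g != i.
  move=> eP gK reg; case: (boolP (g \in D)) => [|gD].
    rewrite !in_setU !in_set1 -!orbA => /or4P[| | |/or3P[]] /eqP g_eq; subst g.
    1-3: by move: eP reg; rewrite !inE -!orbA => /or3P[] /eqP->;
      rewrite ?r_irr ?(negPf npy) ?(negPf ntp) ?(negPf nty) // r_sym
        ?(negPf npy) ?(negPf ntp) ?(negPf nty).
    - by rewrite cv.
    - by rewrite c1.
    - by rewrite c2.
  have gs : g \notin [set s1; s2] by apply: contra gD => gs; rewrite inE gs orbT.
  have [gp gy gv] : [/\ g != p, g != y & g != v].
    by split; apply: contraNneq gD => ->; rewrite !inE eqxx ?orbT.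
  have : r y g || r v g.
    move: eP reg; rewrite !inE -!orbA => /or3P[] /eqP-> reg; last exact: Nt.
      by rewrite Np.
    by rewrite reg.
  rewrite c0 // => /orP[] rg.
    by move/availableP: iY; apply; rewrite ?inE.
  by move/availableP: iv; apply; rewrite // !inE negb_or gp.
move: dD; rewrite in_setU in_setU => /orP[/orP[dP|/set1P d_eq]|dS].
- by rewrite cpyt // eq_sym; apply: pyt_case rdf.
- subst d; rewrite cv; case: (boolP (f \in [set p; y; t])) => fP; first by rewrite cpyt.
  case: (boolP (f \in D)) => [|fD].
    rewrite in_setU in_setU (negPf fP) orFb => /orP[/set1P f_eq|fS].
      by rewrite f_eq r_irr in rdf.
    by have [] := ns f fS; rewrite r_sym rdf.
  rewrite c0 // eq_sym; move/availableP: mV; apply=> //.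
  by apply: contra fP; rewrite !inE => ->.
have : exists k, [/\ c' d = k, k != i & k \in available K c [set p; t] d].
  by move: dS => /set2P[]->; [exists k1 | exists k2].
move=> [k [-> ki kV]].
case: (boolP (f \in [set p; y; t])) => fP; first by rewrite cpyt.
case: (boolP (f \in D)) => [|fD].
  rewrite in_setU in_setU (negPf fP) orFb => /orP[/set1P f_eq|fS].
    by have [] := ns d dS; rewrite -f_eq rdf.
  move: dS fS rdf => /set2P[]-> /set2P[]->; rewrite ?r_irr ?(negPf ns12) //.
  by rewrite r_sym (negPf ns12).
rewrite c0 // eq_sym; move/availableP: kV; apply=> //.
by apply: contra fP; rewrite !inE => /orP[]->; rewrite ?orbT.
Qed.
End CriticalSets.

(** * Conflicting edges of a graph *)

Lemma set2_inj (T : finType) (a b x y : T) :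
  [set a; b] = [set x; y] -> a = x /\ b = y \/ a = y /\ b = x.
Proof.
move=> eq_ab.
have /set2P a_in : a \in [set x; y] by rewrite -eq_ab set21.
have /set2P b_in : b \in [set x; y] by rewrite -eq_ab set22.
have /set2P x_in : x \in [set a; b] by rewrite eq_ab set21.
have /set2P y_in : y \in [set a; b] by rewrite eq_ab set22.
by case: a_in b_in x_in y_in => -> [] -> [] ? [] ?; subst; auto.
Qed.

Lemma card_bigcup_leq (I T : finType) (P : pred I) (F : I -> {set T}) :
  #|\bigcup_(i | P i) F i| <= \sum_(i | P i) #|F i|.
Proof.
apply: (big_ind2 (fun (A : {set T}) m => #|A| <= m)) => [|A m B l Am Bl|//].
  by rewrite cards0.
by apply: leq_trans (leq_card_setU A B).1 (leq_add Am Bl).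
Qed.

Section EdgeConflict.
Variables (T : finType) (g : rel T).

(** The two edges are the ends of a non-backtracking walk [a u x z]. The case [z = a] is allowed and
    yields two edges of a triangle, so this one relation covers both conditions on injective
    colorings. *)
Definition edge_conflict (e f : {set T}) : bool :=
  [exists a, exists u, exists x, exists z,
    [&& e == [set a; u], f == [set x; z], g a u, g u x, g x z, x != a & z != u]].

Lemma edge_conflictP e f :
  reflect (exists a u x z, [/\ e = [set a; u], f = [set x; z],
                              [/\ g a u, g u x & g x z], x != a & z != u])
          (edge_conflict e f).
Proof.
apply: (iffP existsP) => [[a /existsP[u /existsP[x /existsP[z]]]]|].
  by move=> /and5P[/eqP-> /eqP-> ga gu /and3P[gx xa zu]]; exists a, u, x, z.
move=> [a [u [x [z [-> -> [ga gu gx] xa zu]]]]].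
exists a; apply/existsP; exists u; apply/existsP; exists x; apply/existsP; exists z.
by rewrite !eqxx ga gu gx xa zu.
Qed.

Hypotheses (g_sym : symmetric g) (g_irr : irreflexive g).

Lemma edge_conflict_sym : symmetric edge_conflict.
Proof.
move=> e f; apply/edge_conflictP/edge_conflictP.
all: move=> [a [u [x [z [-> -> [ga gu gx] xa zu]]]]]; exists z, x, u, a.
all: by rewrite ![[set z; _]]setUC ![[set u; _]]setUC ![g z _]g_sym ![g x u]g_sym
  ![g u a]g_sym ![_ == z]eq_sym ![a == _]eq_sym; split.
Qed.

Lemma edge_conflict_irr : irreflexive edge_conflict.
Proof.
move=> e; apply/edge_conflictP => -[a [u [x [z [-> /set2_inj eq_e [ga gu gx] xa zu]]]]].
by case: eq_e => -[a_eq u_eq]; subst; rewrite ?eqxx ?g_irr in gu xa.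
Qed.

Lemma edge_conflict_cases u v f : edge_conflict [set u; v] f ->
  exists x z, [/\ f = [set x; z], g x z &
    [/\ g u x, x != v & z != u] \/ [/\ g v x, x != u & z != v]].
Proof.
move=> /edge_conflictP[a [b [x [z [/set2_inj eq_e -> [ga gb gx] xa zb]]]]].
by exists x, z; split=> //; case: eq_e => -[-> ->]; [right | left].
Qed.

Lemma edge_conflict_walk a u x z :
  g a u -> g u x -> g x z -> x != a -> z != u ->
  edge_conflict [set a; u] [set x; z].
Proof. by move=> *; apply/edge_conflictP; exists a, u, x, z. Qed.

End EdgeConflict.

(** * Loads as bounds on the number of conflicts *)

Section CriticalGraph.
Variables (T : finType) (g : rel T) (K : {set {set T}}) (n : nat).
Hypotheses (g_sym : symmetric g) (g_irr : irreflexive g).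
Hypothesis Kg : forall x y, [set x; y] \in K -> g x y.
Hypothesis K_crit : critical (edge_conflict g) n K.

Definition kadj : rel T := fun x y => [set x; y] \in K.
Definition deg (x : T) : nat := #|[set y | g x y]|.
Definition kdeg (x : T) : nat := #|[set y | kadj x y]|.
(* The edges of K at x that conflict, through the edge ux, with the other edges at u. *)
Definition load (u x : T) : nat := #|[set z | kadj x z & z != u]|.
Definition total_load (u : T) : nat := \sum_(x | g u x) load u x.

Lemma kadj_sym x y : kadj x y = kadj y x.
Proof. by rewrite /kadj setUC. Qed.

Lemma load_kdeg u x : load u x + kadj u x = kdeg x.
Proof.
rewrite kadj_sym /kdeg (cardsD1 u) inE addnC; congr addn.
by apply: eq_card => z; rewrite !inE andbC.
Qed.

Lemma load_lt u x : g u x -> load u x < deg x.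
Proof.
move=> gux; rewrite /deg (cardsD1 u) inE g_sym gux ltnS.
by apply/subset_leq_card/subsetP => z; rewrite !inE => /andP[/Kg->->].
Qed.

(** Equality in [load_lt] leaves no neighbor of [x] other than [u] uncounted. *)
Lemma load_full u x z : g u x -> (load u x).+1 = deg x -> g x z -> z != u -> kadj x z.
Proof.
move=> gux; rewrite /deg (cardsD1 u) inE g_sym gux add1n => -[eq_l] gxz zu.
have sub : [set z | kadj x z & z != u] \subset [set y | g x y] :\ u.
  by apply/subsetP => y; rewrite !inE => /andP[/Kg->->].
have /eqP/setP/(_ z) : [set z | kadj x z & z != u] == [set y | g x y] :\ u.
  by rewrite eqEcard sub -eq_l leqnn.
by rewrite !inE gxz zu andbT.
Qed.

(** Once the degree is known, the list unfolds and sums over neighbors become explicit, with a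
    chosen neighbor in front. *)
Lemma nbr_list u v : g u v -> exists s, [/\ uniq (v :: s), (size s).+1 = deg u,
  forall x, g u x = (x \in v :: s) &
  forall F : T -> nat, \sum_(x | g u x) F x = F v + \sum_(x <- s) F x].
Proof.
move=> guv; exists (enum [set x | g u x & x != v]); split.
- by rewrite /= enum_uniq mem_enum inE eqxx andbF.
- rewrite -cardE /deg (cardsD1 v [set y | g u y]) inE guv add1n; congr S.
  by apply: eq_card => x; rewrite !inE andbC.
- by move=> x; rewrite inE mem_enum inE; case: eqVneq => [->|]; rewrite // andbT.
- by move=> F; rewrite (bigD1 v) //= big_enum; congr addn; apply: eq_bigl => x; rewrite inE.
Qed.

Lemma kdeg_sum x : kdeg x = \sum_(z | g x z) kadj x z.
Proof.
rewrite /kdeg -sum1_card big_mkcond [RHS]big_mkcond /=; apply: eq_bigr => z _.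
by rewrite inE; case kxz: (kadj x z); [rewrite (Kg kxz) | case: ifP].
Qed.

(** A conflict of [uv] is an edge of [K] at another neighbor of [u] or [v]. An edge that is reached
    in several ways is counted several times, hence only an inequality. *)
Lemma card_conflicts u v : g u v ->
  #|conflicts (edge_conflict g) K [set u; v]| + load u v + load v u
    <= total_load u + total_load v.
Proof.
pose A u v := \bigcup_(x | g u x && (x != v))
  [set [set x; z] | z in [set z | kadj x z & z != u]].
have card_A a b : g a b -> #|A a b| + load a b <= total_load a.
  move=> gab; rewrite /total_load (bigD1 b) //= addnC leq_add2l.
  apply: leq_trans (card_bigcup_leq _ _) _; apply: leq_sum => x _.
  exact: leq_imset_card.
move=> guv; have gvu : g v u by rewrite g_sym.
have sub : conflicts (edge_conflict g) K [set u; v] \subset A u v :|: A v u.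
  apply/subsetP => f; rewrite inE => /andP[fK /edge_conflict_cases].
  move=> [x [z [f_eq gxz h]]]; rewrite f_eq in fK *; rewrite inE.
  by case: h => -[gx xv zu]; apply/orP; [left | right]; apply/bigcupP; exists x;
    rewrite ?gx //; apply: imset_f; rewrite inE zu andbT.
have := leq_trans (subset_leq_card sub) (leq_card_setU _ _).1.
by have := card_A _ _ guv; have := card_A _ _ gvu; clear; lia.
Qed.

(** The source of the lower bounds on loads: criticality demands [n] conflicts, against the upper
    bound of [card_conflicts]. *)
Lemma kadj_load u v : kadj u v ->
  n + load u v + load v u <= total_load u + total_load v.
Proof.
move=> kuv; apply: leq_trans (card_conflicts (Kg kuv)).
rewrite !leq_add2r; apply: critical_degree => //.
- exact: edge_conflict_sym.
- exact: edge_conflict_irr.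
Qed.

End CriticalGraph.

(** * Discharging *)

(** What a payment [m] implies about the load [l] of its receiver and the total load [S] of the
    payer. The flag [Y] marks 3-vertices satisfying [has_two_deg2]. *)
Definition give_bound (Y : bool) (m l S : nat) : Prop :=
  [\/ [\/ m = 0, m = 1 /\ l <= 2 | m = 2 /\ l <= 1], [/\ m = 2, l <= 2 & Y]
    | [/\ m = 4, l = 0 & 6 <= S]].

(** This treats the three neighbors left when a fourth one, of load 0, is paid 4. If one of the
    three is paid 4 as well, the other two have load 3 and are unpaid. Otherwise a sum above 4 needs
    three paid neighbors, all of load 2, two of them marked; the last hypotheses then ask for a
    total load of 7 instead of 6. *)
Lemma give_bound_sum Yb Yc Yd gb gc gd lb lc ld (S := lb + lc + ld) :
  give_bound Yb gb lb S -> give_bound Yc gc lc S -> give_bound Yd gd ld S ->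
  [&& lb <= 3, lc <= 3 & ld <= 3] -> 6 <= S ->
  (Yb -> Yc -> 5 + lb <= S) -> (Yb -> Yd -> 5 + lb <= S) -> (Yc -> Yd -> 5 + lc <= S) ->
  gb + gc + gd <= 4.
Proof.
rewrite /S => hb hc hd /and3P[b3 c3 d3] S6 bc bd cd.
case: hb => [[?|[? ?]|[? ?]]|[? ? hYb]|[? ? _]];
case: hc => [[?|[? ?]|[? ?]]|[? ? hYc]|[? ? _]]; try (clear bc bd cd hd; lia);
case: hd => [[?|[? ?]|[? ?]]|[? ? hYd]|[? ? _]]; try (clear bc bd cd; lia).
all: try (have := bc hYb hYc; clear bc bd cd; lia);
  try (have := bd hYb hYd; clear bc bd cd; lia); try (have := cd hYc hYd; clear bc bd cd; lia).
Qed.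

Section Discharging.
Variables (T : finType) (g : rel T) (K : {set {set T}}).
Hypotheses (g_sym : symmetric g) (g_irr : irreflexive g).
Hypothesis Kg : forall x y, [set x; y] \in K -> g x y.
Hypothesis K_crit : critical (edge_conflict g) 7 K.
Hypothesis deg_le4 : forall x, deg g x <= 4.
Hypothesis K_cover : forall x y, g x y -> exists z, kadj K x z.

Local Notation deg := (deg g).
Local Notation kadj := (kadj K).
Local Notation kdeg := (kdeg K).
Local Notation load := (load K).
Local Notation total_load := (total_load g K).

(* With v of degree 2, a weak neighbor w of v brings at most one conflict to
   the other edge at v, and pays nothing to v. *)
Definition weak (w v : T) : bool := ~~ kadj v w && (kdeg w <= 1).

Definition strong (w v : T) : bool := [exists u, [&& g v u, u != w & weak u v]].

Definition has_strong_nbr (y : T) : bool :=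
  [exists x, [&& g y x, deg x == 2 & strong y x]].

(** The sum counts the neighbors of degree 2. The condition on [kdeg] prevents [y] from being weak,
    so [y] has to pay both of them. *)
Definition has_two_deg2 (y : T) : bool :=
  (2 <= kdeg y) && (\sum_(x | g y x) (deg x == 2) == 2).

(* Payments are in units of 1/6. *)
Definition give (w v : T) : nat :=
  if deg v == 2 then if weak w v then 0 else if strong w v then 4 else 2
  else if (deg v == 3) && (deg w == 4) then
    if has_strong_nbr v then 1 else if has_two_deg2 v then 2 else 0
  else 0.

Let gE x y : g x y = g y x := g_sym x y.
Let load7 u v := @kadj_load T g K 7 g_sym g_irr Kg K_crit u v.
Let load_kd u x := load_kdeg K u x.
Let load_ltd u x := @load_lt T g K g_sym Kg u x.

(** * Structure around leaves, 2-vertices and 3-vertices *)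

Lemma kdeg_gt0 x y : g x y -> 0 < kdeg x.
Proof. by move=> /K_cover[z kxz]; apply/card_gt0P; exists z; rewrite inE. Qed.

Lemma load_le3 u x : g u x -> load u x <= 3.
Proof. by move=> /load_ltd; have := deg_le4 x; lia. Qed.

Lemma nbrs1 v w : deg v = 1 -> g v w ->
  (forall x, g v x = (x == w)) /\ (forall F : T -> nat, \sum_(x | g v x) F x = F w).
Proof.
move=> dv gvw; have [[|a s] [_ /eqP]] := nbr_list gvw; rewrite dv // => _ gP sP.
by split=> [x|F]; rewrite ?gP ?inE // sP big_nil addn0.
Qed.

Lemma nbrs2 v w : deg v = 2 -> g v w -> exists u, [/\ u != w, g v u,
  forall x, g v x = (x == w) || (x == u) &
  forall F : T -> nat, \sum_(x | g v x) F x = F w + F u].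
Proof.
move=> dv gvw; have [s [+ /eqP]] := nbr_list gvw; rewrite dv.
case: s => [|u [|? ?]] //= ; rewrite andbT inE => uw _ gP sP.
exists u; split=> [|||F]; first by rewrite eq_sym.
- by rewrite gP !inE eqxx orbT.
- by move=> x; rewrite gP !inE.
- by rewrite sP big_seq1.
Qed.

Lemma nbrs3 v a b : deg v = 3 -> g v a -> g v b -> a != b ->
  exists c, [/\ c != a, c != b, g v c,
  forall x, g v x = [|| x == a, x == b | x == c] &
  forall F : T -> nat, \sum_(x | g v x) F x = F a + F b + F c].
Proof.
move=> dv gva gvb ab; have [s [+ /eqP]] := nbr_list gva; rewrite dv.
case: s => [|c [|d [|? ?]]] //=; rewrite !inE !negb_or andbT => /andP[/andP[ac ad] cd] _ gP sP.
have := gvb; rewrite gP !inE eq_sym (negPf ab) /= => /orP[] /eqP b_eq; subst b.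
- exists d; rewrite ![d == _]eq_sym ad cd; split=> // [|x|F].
  + by rewrite gP !inE eqxx !orbT.
  + by rewrite gP !inE.
  + by rewrite sP !big_cons big_nil; lia.
- exists c; rewrite eq_sym ac cd; split=> // [|x|F].
  + by rewrite gP !inE eqxx !orbT.
  + by rewrite gP !inE; congr orb; rewrite orbC.
  + by rewrite sP !big_cons big_nil; lia.
Qed.

Lemma nbrs3_ex v a : deg v = 3 -> g v a -> exists2 b, g v b & a != b.
Proof.
move=> dv gva; have [s [+ /eqP]] := nbr_list gva; rewrite dv.
case: s => [|c s] //=; rewrite !inE !negb_or => /andP[/andP[ac _] _] _ gP _.
by exists c => //; rewrite gP !inE eqxx orbT.
Qed.

Lemma nbrs4 v a : deg v = 4 -> g v a ->
  exists b c d, [/\ [/\ b != a, c != a & d != a], [/\ b != c, b != d & c != d],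
  [/\ g v b, g v c & g v d],
  forall x, g v x = [|| x == a, x == b, x == c | x == d] &
  forall F : T -> nat, \sum_(x | g v x) F x = F a + F b + F c + F d].
Proof.
move=> dv gva; have [s [+ /eqP]] := nbr_list gva; rewrite dv.
case: s => [|b [|c [|d [|? ?]]]] //=; rewrite !inE !negb_or andbT.
move=> /and3P[/and3P[ab ac ad] /andP[bc bd] cd] _ gP sP.
exists b, c, d; split=> [|||x|F]; last by rewrite sP !big_cons big_nil; lia.
- by rewrite ![_ == a]eq_sym.
- by [].
- by rewrite !gP !inE !eqxx !orbT.
- by rewrite gP !inE.
Qed.

(** In [kadj_load] the load of [q] on [p] cancels, which leaves a total load of at least 7 on [q].
    The leaf has load 0 and all other loads are at most 3, so [q] has three more neighbors. *)
Lemma leaf_nbr p q : g p q -> deg p = 1 ->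
  [/\ deg q = 4, kadj p q, load q p = 0 & 7 <= total_load q].
Proof.
move=> gpq dp; have [gP sP] := nbrs1 dp gpq; have gqp : g q p by rewrite gE.
have kpq : kadj p q.
  by have [z kpz] := K_cover gpq; have := Kg kpz; rewrite gP => /eqP <-.
have lqp : load q p = 0 by have := load_ltd gqp; rewrite dp; lia.
have Sq : 7 <= total_load q.
  by have := load7 kpq; rewrite {1}/total_load sP lqp; clear; lia.
split=> //; have [s [_ szq gQ sQ]] := nbr_list gqp.
have sL x : x \in s -> load q x <= 3 by move=> xs; apply: load_le3; rewrite gQ inE xs orbT.
move: Sq szq sL; rewrite /total_load sQ lqp.
case: s {gQ sQ} => [|a [|b [|c s]]] /=; rewrite ?big_cons ?big_nil; first by lia.
- by move=> ? _ /(_ a); rewrite inE eqxx; lia.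
- move=> ? _ lab; have := lab a; have := lab b; rewrite !inE !eqxx orbT; lia.
- by move=> _ ? _; have := deg_le4 q; lia.
Qed.

(** Let [u] be the weak neighbor of [v]. Since [vu] is not in [K] and [v] meets [K], the edge [vw]
    is in [K]. At most one of its 7 conflicts comes through [u], so at least 6 come through [w]. *)
Lemma strong_load w v : g w v -> deg v = 2 -> strong w v ->
  [/\ kadj w v, load w v = 0 & 6 <= total_load w].
Proof.
move=> gwv dv /existsP[u /and3P[gvu uw /andP[kuv ku]]].
have gvw : g v w by rewrite gE.
have [u' [_ gvu' gP sP]] := nbrs2 dv gvw.
have eq_u : u = u' by move: gvu; rewrite gP (negPf uw) => /eqP.
subst u'; have kv := kdeg_gt0 gvw; have kd := kdeg_sum Kg v; rewrite sP in kd.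
have kvu : kadj v u = false by apply/negbTE.
have kvw : kadj v w by move: kv; rewrite kd kvu; case: (kadj v w).
have kwv : kadj w v by rewrite kadj_sym.
have lw := load_kd w v; have lu := load_kd v u; rewrite kvu in lu.
rewrite kwv kd kvw kvu /= in lw.
have := load7 kwv; rewrite {2}/total_load sP; move: lw lu ku; split=> //; lia.
Qed.

Lemma strong_weak w v : g w v -> deg v = 2 -> strong w v -> weak w v = false.
Proof. by move=> gwv dv /(strong_load gwv dv)[kwv _ _]; rewrite /weak kadj_sym kwv. Qed.

Lemma give4 w v : g w v -> give w v = 4 ->
  [/\ deg v = 2, kadj w v, load w v = 0, 6 <= total_load w & strong w v].
Proof.
move=> gwv; rewrite /give; case: eqP => [dv|_].
  case: ifP => // _; case: ifP => // st _; by have [] := strong_load gwv dv st.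
by do 3?case: ifP.
Qed.

Lemma give_strong w v : g w v -> deg v = 2 -> strong w v -> give w v = 4.
Proof. by move=> gwv dv st; rewrite /give dv eqxx strong_weak ?st. Qed.

Lemma has_strong_nbrP y : reflect (exists2 x, g y x & give y x = 4) (has_strong_nbr y).
Proof.
apply: (iffP existsP) => [[x /and3P[gyx /eqP dx st]]|[x gyx /(give4 gyx)[dx _ _ _ st]]].
  by exists x => //; apply: give_strong.
by exists x; rewrite gyx dx st.
Qed.

Variant give_spec w v : nat -> Prop :=
| Give0 : give_spec w v 0
| Give1 of deg v = 3 & deg w = 4 & has_strong_nbr v : give_spec w v 1
| Give2 of deg v = 2 & weak w v = false : give_spec w v 2
| Give2' of deg v = 3 & deg w = 4 & has_two_deg2 v : give_spec w v 2
| Give4 of deg v = 2 & strong w v : give_spec w v 4.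

Lemma giveP w v : g w v -> give_spec w v (give w v).
Proof.
move=> gwv; rewrite /give; case: eqP => dv.
  by case: ifP => wk; [constructor | case: ifP => st; constructor].
case: ifP => [/andP[/eqP dv3 /eqP dw]|_]; last by constructor.
by case: ifP => hs; [constructor | case: ifP => td; constructor].
Qed.

(** As [kdeg y] is at least 2, [K] has an edge from [y] to one of the 2-vertices. Its 7 conflicts
    are bounded by three loads of at most 3, 1 and 3, so the count is tight and the load of [w] is
    3. *)
Lemma two_deg2_nbrs y w : deg y = 3 -> deg w = 4 -> g w y -> has_two_deg2 y ->
  exists v1 v2, [/\ [/\ v1 != w, v2 != w & v1 != v2], [/\ g y v1, g y v2, deg v1 = 2 & deg v2 = 2],
    forall x, g y x = [|| x == w, x == v1 | x == v2],
    forall F : T -> nat, \sum_(x | g y x) F x = F w + F v1 + F v2 &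
    load y w = 3].
Proof.
move=> dy dw gwy /andP[ky /eqP cnt]; have gyw : g y w by rewrite gE.
have [v1 gyv1 wv1] := nbrs3_ex dy gyw.
have [v2 [v2w v2v1 gyv2 gP sP]] := nbrs3 dy gyw gyv1 wv1.
move: cnt; rewrite sP dw /=; have [[d1|?] [d2|?] //=] := (deg v1 =P 2, deg v2 =P 2) => _.
have half v v' : g y v -> g y v' -> deg v = 2 -> deg v' = 2 -> kadj y v ->
    (forall F : T -> nat, \sum_(x | g y x) F x = F w + F v + F v') -> load y w = 3.
  move=> gyv gyv' dv dv' kyv sP'; have := load7 kyv.
  have gvy : g v y by rewrite gE.
  have [u [_ gvu _ sV]] := nbrs2 dv gvy.
  have := load_le3 gyw; have := load_le3 gvu; have := load_ltd gyv'.
  by rewrite dv' /total_load sP' sV; clear; lia.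
exists v1, v2; split=> //; first by rewrite eq_sym wv1 v2w eq_sym.
have kd := kdeg_sum Kg y; rewrite sP in kd.
have [k1|k1] := boolP (kadj y v1); first exact: (half v1 v2).
apply: (half v2 v1) => //; last by move=> F; rewrite sP addnAC.
by move: ky; rewrite kd (negPf k1); case: (kadj y v2) (kadj y w) => [] [].
Qed.

Lemma two_deg2_kadj y w x : deg y = 3 -> deg w = 4 -> g w y -> has_two_deg2 y ->
  g w x -> x != y -> kadj w x.
Proof.
move=> dy dw gwy td gwx xy; have [? [? [_ _ _ _ ly]]] := two_deg2_nbrs dy dw gwy td.
by apply: (load_full g_sym Kg (u := y)) => //; rewrite ?ly ?dw // gE.
Qed.

(** The edge [wy] is in [K] because of [z]. Besides the load of [w], the loads on [y] come from two
    2-vertices and add up to at most 2, so [w] must account for 5 of the 7 conflicts. *)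
Lemma two_deg2_pair y z w : deg y = 3 -> deg z = 3 -> deg w = 4 -> g w y -> g w z ->
  has_two_deg2 y -> has_two_deg2 z -> y != z -> 5 + load w y <= total_load w.
Proof.
move=> dy dz dw gwy gwz tdy tdz yz; have kwy := two_deg2_kadj dz dw gwz tdz gwy yz.
have [v1 [v2 [_ [gy1 gy2 d1 d2] _ sP _]]] := two_deg2_nbrs dy dw gwy tdy.
have := load7 kwy; have := load_ltd gy1; have := load_ltd gy2.
by rewrite {2}/total_load sP d1 d2; clear; lia.
Qed.

Lemma give_boundP w v : g w v ->
  give_bound ((deg v == 3) && has_two_deg2 v) (give w v) (load w v) (total_load w).
Proof.
move=> gwv; have := load_ltd gwv.
case: (giveP gwv) => [|dv dw hs|dv _|dv dw td|dv st]; rewrite ?dv ?ltnS => lt.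
- by do 2 constructor 1.
- by constructor 1; constructor 2.
- by constructor 1; constructor 3.
- by constructor 2.
- by have [_ ? ?] := strong_load gwv dv st; constructor 3.
Qed.

Lemma deg_gt0_nbr w : 0 < deg w -> exists a, g w a.
Proof. by case/card_gt0P => a; rewrite inE; exists a. Qed.

(** The bound is 6 (4 - 8/3), the charge of a vertex of degree 4 in units of payment. Without a
    payment of 4 each neighbor receives at most 2; with one, [give_bound_sum] bounds the other three
    together. *)
Lemma give_deg4 w : deg w = 4 ->
  \sum_(x | g w x) give w x <= 8.
Proof.
move=> dw; have [/existsP[a /andP[gwa /eqP ga4]]|no4] :=
  boolP [exists a, g w a && (give w a == 4)].
  have [_ _ la S6 _] := give4 gwa ga4.
  have [b [c [d [[ba ca da] [bc bd cd] [gwb gwc gwd] _ sP]]]] := nbrs4 dw gwa.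
  have S_eq : total_load w = load w b + load w c + load w d by rewrite /total_load sP la.
  have pair x y : g w x -> g w y -> x != y -> (deg x == 3) && has_two_deg2 x ->
      (deg y == 3) && has_two_deg2 y -> 5 + load w x <= load w b + load w c + load w d.
    move=> gx gy xy /andP[/eqP dx tx] /andP[/eqP dy ty].
    by rewrite -S_eq; apply: (two_deg2_pair dx dy).
  rewrite sP ga4 -!addnA leq_add2l addnA.
  apply: (@give_bound_sum ((deg b == 3) && has_two_deg2 b) ((deg c == 3) && has_two_deg2 c)
    ((deg d == 3) && has_two_deg2 d) _ _ _ (load w b) (load w c) (load w d)); rewrite -?S_eq //.
  - exact: give_boundP.
  - exact: give_boundP.
  - exact: give_boundP.
  - by rewrite !load_le3.
  - by rewrite S_eq; apply: pair.
  - by rewrite S_eq; apply: pair.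
  - by rewrite S_eq; apply: pair.
apply: leq_trans (_ : \sum_(x | g w x) 2 <= 8).
  apply: leq_sum => x gwx; case: (give_boundP gwx) => [[->|[-> _]|[-> _]]|[->]|[g4]] //.
  by case/existsP: no4; exists x; rewrite gwx g4.
by rewrite sum_nat_const; have -> : #|g w| = 4; rewrite // -dw; apply: eq_card => x; rewrite inE.
Qed.

(** * Reducible configurations around a 4-vertex with a leaf *)

Let conf := edge_conflict g.

Lemma conf_le7 u v : g u v -> total_load u + total_load v <= 7 + load u v + load v u ->
  #|conflicts conf K [set u; v]| <= 7.
Proof.
move=> guv le_S; have := leq_trans (card_conflicts K g_sym guv) le_S.
by rewrite !leq_add2r.
Qed.

Lemma conf_walk a u x z : g a u -> g u x -> g x z -> x != a -> z != u ->
  conf [set a; u] [set x; z].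
Proof. exact: edge_conflict_walk. Qed.

(** Edges sharing a vertex can conflict only inside a triangle. *)
Lemma no_conf_adjacent u v w : ~~ g u w -> ~~ conf [set u; v] [set v; w].
Proof.
move=> nuw; apply/negP => /edge_conflict_cases[x [z [/set2_inj eq_f gxz]]].
case=> -[gx xv zu]; case: eq_f => -[x_eq z_eq]; subst.
- by rewrite eqxx in xv.
- by rewrite gx in nuw.
- by rewrite g_irr in gx.
- by rewrite eqxx in zu.
Qed.

(** The tight count 7 = 3 + 1 + 3 of [two_deg2_nbrs] also bounds the conflicts of [yv] from above
    and gives the other neighbor of [v] load 3, hence degree 4. *)
Lemma two_deg2_far y w v : deg y = 3 -> deg w = 4 -> g w y -> has_two_deg2 y ->
  g y v -> v != w -> kadj y v ->
  [/\ deg v = 2, #|conflicts conf K [set y; v]| <= 7 &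
      forall u, g v u -> u != y -> deg u = 4].
Proof.
move=> dy dw gwy td gyv vw kyv; have gvy : g v y by rewrite gE.
have [v1 [v2 [_ [g1 g2 d1 d2] gP sP lyw]]] := two_deg2_nbrs dy dw gwy td.
have [v' [gyv' dv' dv sY]] : exists v', [/\ g y v', deg v' = 2, deg v = 2 &
    forall F : T -> nat, \sum_(x | g y x) F x = F w + F v + F v'].
  move: gyv; rewrite gP (negPf vw) /= => /orP[] /eqP ->; first by exists v2.
  by exists v1; split=> // F; rewrite sP addnAC.
have [u [uy gvu gV sV]] := nbrs2 dv gvy.
have lv' := load_ltd gyv'; have lu := load_le3 gvu.
split=> // [|x].
  apply: conf_le7 => //; rewrite /total_load sY sV; move: lv' lu; rewrite dv' lyw.
  by clear; lia.
rewrite gV => /orP[/eqP->|/eqP-> _]; first by rewrite eqxx.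
have := load7 kyv; have := load_ltd gvu; have := deg_le4 u; move: lv'.
by rewrite /total_load sY sV lyw dv'; clear; lia.
Qed.

(* The 4-vertex q has a leaf p and two neighbors y and r of degree 3. *)
Section Leafed.
Variables p q c y r : T.
Hypotheses (dp : deg p = 1) (dq : deg q = 4) (dy : deg y = 3) (dr : deg r = 3).
Hypotheses (py : p != y) (pr : p != r) (yr : y != r).
Hypotheses (gqp : g q p) (gqc : g q c) (gqy : g q y) (gqr : g q r).
Hypothesis gQ : forall x, g q x = [|| x == p, x == c, x == y | x == r].
Hypothesis sQ : forall F : T -> nat, \sum_(x | g q x) F x = F p + F c + F y + F r.

Let gpq : g p q. Proof. by rewrite gE. Qed.
Let gyq : g y q. Proof. by rewrite gE. Qed.
Let grq : g r q. Proof. by rewrite gE. Qed.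

(** The leaf forces a total load of 7 on [q], and 0 + 3 + 2 + 2 is the most that the degrees
    allow. *)
Lemma leafed_loads : [/\ load q p = 0, load q c = 3, load q y = 2, load q r = 2 & kadj p q].
Proof.
have [_ kpq lqp] := leaf_nbr gpq dp; rewrite /total_load sQ.
have := load_le3 gqc; have := load_ltd gqy; have := load_ltd gqr; rewrite dy dr lqp.
suff arith a b d : b < 3 -> a < 3 -> d <= 3 -> 6 < 0 + d + a + b -> [/\ d = 3, a = 2 & b = 2].
  by move=> h1 h2 h3 h4; have [-> -> ->] := arith _ _ _ h1 h2 h3 h4.
by clear; split; lia.
Qed.

Lemma leafed_deg c' : deg c' = 2 -> ~~ g q c'.
Proof.
move=> dc; apply/negP; rewrite gQ => /or4P[] /eqP c_eq; move: dc; rewrite c_eq ?dp ?dy ?dr // => dc.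
by have [_ lc _ _ _] := leafed_loads; have := load_ltd gqc; rewrite dc lc.
Qed.

Lemma leaf_conflicts_le : #|conflicts conf K [set p; q]| <= 7.
Proof.
have [l0 lc ly lr _] := leafed_loads; have [_ sP] := nbrs1 dp gpq.
by apply: conf_le7 => //; rewrite /total_load sP sQ l0 lc ly lr; clear; lia.
Qed.

Lemma leafed_kadj x z : x \in [:: y; r] -> g x z -> z != q -> kadj x z.
Proof.
have [_ _ ly lr _] := leafed_loads.
by rewrite !inE => /orP[] /eqP->; apply: (load_full g_sym Kg (u := q)) => //;
  rewrite ?ly ?lr ?dy ?dr.
Qed.

Lemma qy_conflicts_le : has_two_deg2 y -> #|conflicts conf K [set q; y]| <= 7.
Proof.
move=> tdy; have [v1 [v2 [_ [g1 g2 d1 d2] _ sP lyw]]] := two_deg2_nbrs dy dq gqy tdy.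
have [l0 lc ly lr _] := leafed_loads.
apply: conf_le7 => //; rewrite /total_load sQ sP l0 lc ly lr lyw.
by have := load_ltd g1; have := load_ltd g2; rewrite d1 d2; clear; lia.
Qed.

(** The edges [pq] and [qy], against the edges from [r] to its two 2-neighbors, form an induced
    4-cycle of conflicts, so [critical_no_C4] applies. *)
Lemma not_two_deg2_two_deg2 : has_two_deg2 y -> ~~ has_two_deg2 r.
Proof.
move=> tdy; apply/negP => tdr.
have [a [b [[aq bq ab] [gra grb da db] _ _ _]]] := two_deg2_nbrs dr dq gqr tdr.
have [_ _ _ _ kpq] := leafed_loads.
have kqy := two_deg2_kadj dr dq gqr tdr gqy yr.
have rin : r \in [:: y; r] by rewrite !inE eqxx orbT.
have kra := leafed_kadj rin gra aq; have krb := leafed_kadj rin grb bq.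
have [_ ra7 a_far] := two_deg2_far dr dq gqr tdr gra aq kra.
have [_ rb7 _] := two_deg2_far dr dq gqr tdr grb bq krb.
have gar : g a r by rewrite gE.
apply: (@critical_no_C4 _ conf 7 (edge_conflict_sym g_sym) (edge_conflict_irr g_irr) K K_crit
  [set p; q] [set q; y] [set r; a] [set r; b]).
- move=> e; rewrite !inE -!orbA => /or4P[] /eqP->.
  + by split; [exact: kpq | exact: leaf_conflicts_le].
  + by split; [exact: kqy | exact: qy_conflicts_le].
  + by split; [exact: kra | exact: ra7].
  + by split; [exact: krb | exact: rb7].
- apply/eqP => /set2_inj[] [p_eq _]; first by move: gpq; rewrite p_eq g_irr.
  by move: py; rewrite p_eq eqxx.
- apply/eqP => /set2_inj[] [r_eq a_eq]; first by rewrite a_eq eqxx in ab.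
  by rewrite a_eq g_irr in gar.
- apply: no_conf_adjacent; rewrite (nbrs1 dp gpq).1.
  by apply: contraTneq gqy => ->; rewrite g_irr.
(* [a] and [b] are not adjacent: a neighbor of [a] other than [r] has degree 4, while [b] has degree
   2. *)
- rewrite [[set r; a]]setUC; apply: no_conf_adjacent; apply/negP => /a_far.
  have br : b != r by apply: contraTneq grb => ->; rewrite g_irr.
  by move/(_ br); rewrite db.
- by apply: conf_walk => //; rewrite 1?eq_sym.
- by apply: conf_walk => //; rewrite 1?eq_sym.
- by rewrite [[set q; y]]setUC; apply: conf_walk => //; rewrite 1?eq_sym.
- by rewrite [[set q; y]]setUC; apply: conf_walk => //; rewrite 1?eq_sym.
Qed.

(** Let [v] be a 2-neighbor of [r] for which [r] is strong. Then [critical_no_fork] applies with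
    [pq], [qy], [rv], [qr] as [p], [y], [v], [t], and with the edges from [y] to its 2-neighbors as
    [s1], [s2]. *)
Lemma not_two_deg2_has_strong_nbr : has_two_deg2 y -> ~~ has_strong_nbr r.
Proof.
move=> tdy; apply/negP => /existsP[v /and3P[grv /eqP dv st]].
have gvr : g v r by rewrite gE.
have [_ _ _ _ kpq] := leafed_loads.
have vq : v != q by apply: contraTneq isT => v_eq; move: dv; rewrite v_eq dq.
have qv : q != v by rewrite eq_sym.
have [b [bq bv grb gR sR]] := nbrs3 dr grq grv qv.
have [krv lrv] := strong_load grv dv st; rewrite /total_load sR lrv => S6.
have lrb := load_le3 grb; have lrq := load_le3 grq.
(* The loads on [r] add up to at least 6, and that of [v] is 0. *)
have [lrq3 lrb3] : load r q = 3 /\ load r b = 3.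
  by move: S6 lrb lrq; clear; lia.
have db : deg b = 4.
  by have := load_ltd grb; have := deg_le4 b; rewrite lrb3; clear; lia.
have [u /and3P[gvu ur /andP[kvu ku]]] := existsP st.
have [u' [_ gvu' gV sV]] := nbrs2 dv gvr.
have eq_u : u = u' by move: gvu; rewrite gV (negPf ur) => /eqP.
subst u'.
have lvu : load v u <= 1.
  by apply: leq_trans ku; rewrite -(load_kd v u) leq_addr.
have [v1 [v2 [[v1q v2q v12] [gy1 gy2 d1 d2] gY _ _]]] := two_deg2_nbrs dy dq gqy tdy.
have yin : y \in [:: y; r] by rewrite !inE eqxx.
have rin : r \in [:: y; r] by rewrite !inE eqxx orbT.
have ky1 := leafed_kadj yin gy1 v1q; have ky2 := leafed_kadj yin gy2 v2q.
have [_ y17 far1] := two_deg2_far dy dq gqy tdy gy1 v1q ky1.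
have [_ y27 far2] := two_deg2_far dy dq gqy tdy gy2 v2q ky2.
have kqr : kadj q r by apply: (two_deg2_kadj dy dq gqy tdy gqr); rewrite eq_sym.
have kqy : kadj q y.
  by apply: (load_full g_sym Kg (u := r)); rewrite ?lrq3 ?dq.
have rv7 : #|conflicts conf K [set r; v]| <= 7.
  apply: conf_le7 => //; rewrite /total_load sR sV lrq3 lrb3 lrv.
  by move: lvu; clear; lia.
have qr : q != r by apply: contraTneq gqr => ->; rewrite g_irr.
have qy : q != y by apply: contraTneq gqy => ->; rewrite g_irr.
have nry : ~~ g r y.
  by rewrite gR; apply/negP => /or3P[] /eqP y_eq; move: dy; rewrite y_eq ?dq ?dv ?db.
have npy : ~~ g p y by rewrite (nbrs1 dp gpq).1 eq_sym.
have far i : i \in [set v1; v2] -> [/\ g y i, deg i = 2, i != q &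
    forall u, g i u -> u != y -> deg u = 4].
  by move=> /set2P[]->.
have yS z : g y z -> z != q -> [set y; z] \in [set [set y; v1]; [set y; v2]].
  by rewrite gY => /or3P[] /eqP->; rewrite ?eqxx // !inE eqxx ?orbT.
have conf_y x z : g q x -> x != y -> g x z -> z != q -> conf [set q; y] [set x; z].
  by move=> gqx xy gxz zq; rewrite [[set q; y]]setUC; apply: conf_walk.
apply: (@critical_no_fork _ conf 7 (edge_conflict_sym g_sym) (edge_conflict_irr g_irr) K K_crit
  [set p; q] [set q; y] [set r; v] [set q; r] [set y; v1] [set y; v2]).
- move=> e; rewrite !inE -!orbA => /or4P[|||/orP[]] /eqP->.
  + by split; [exact: kpq | exact: leaf_conflicts_le].
  + by split; [exact: kqy | exact: qy_conflicts_le].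
  + by split; [exact: krv | exact: rv7].
  + by split; [exact: ky1 | exact: y17].
  + by split; [exact: ky2 | exact: y27].
- split.
  + by apply/eqP => /set2_inj[] [p_eq _]; move: gpq py; rewrite p_eq ?g_irr ?eqxx.
  + by apply/eqP => /set2_inj[] [p_eq _]; move: gpq pr; rewrite p_eq ?g_irr ?eqxx.
  + apply/eqP => /set2_inj[] [y_eq v_eq]; first by rewrite v_eq eqxx in v12.
    by move: gy1; rewrite v_eq g_irr.
- exact: kqr.
- split.
  + by apply: conf_walk => //; rewrite eq_sym.
  + by apply: conf_y => //; rewrite eq_sym.
  + move=> s /set2P sS; have [i iS ->] : exists2 i, i \in [set v1; v2] & s = [set y; i].
      by case: sS => ->; [exists v1 | exists v2]; rewrite // !inE eqxx ?orbT.
    have [gyi _ iq _] := far i iS; have giy : g i y by rewrite gE.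
    rewrite [[set y; i]]setUC [[set p; q]]setUC.
    by split; apply: conf_walk => //; rewrite 1?eq_sym.
- split.
  + exact: no_conf_adjacent.
  + rewrite [[set q; r]]setUC [[set p; q]]setUC; apply: no_conf_adjacent.
    by rewrite gE (nbrs1 dp gpq).1 eq_sym.
  + by rewrite [[set q; r]]setUC; apply: no_conf_adjacent.
  + by apply: no_conf_adjacent; apply: leafed_deg.
  + rewrite [[set y; v1]]setUC; apply: no_conf_adjacent; apply/negP => /far1.
    have v2y : v2 != y by apply: contraTneq gy2 => ->; rewrite g_irr.
    by move/(_ v2y); rewrite d2.
- move=> s /set2P sS; have [i iS ->] : exists2 i, i \in [set v1; v2] & s = [set y; i].
    by case: sS => ->; [exists v1 | exists v2]; rewrite // !inE eqxx ?orbT.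
  have [gyi di iq fari] := far i iS.
  split; last first.
    rewrite [[set y; i]]setUC [[set q; y]]setUC; apply: no_conf_adjacent.
    by rewrite gE leafed_deg.
  (* A conflict would make [r] adjacent to [y], or put [r] or [v] beyond a 2-neighbor of [y], where
     all degrees are 4. *)
  apply/negP => /edge_conflict_cases[x [z [/set2_inj rv_eq _ [[gyx xi _]|[gix xy _]]]]].
    case: rv_eq => -[r_eq v_eq]; first by move: nry; rewrite gE r_eq gyx.
    have vS : v \in [set v1; v2].
      by move: gyx; rewrite -v_eq gY (negPf vq) /= !inE.
    have [_ _ _ farv] := far v vS.
    by have := farv r gvr; rewrite dr eq_sym yr => /(_ isT).
  by have := fari x gix xy; case: rv_eq => -[r_eq v_eq]; rewrite -?r_eq -?v_eq ?dr ?dv.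
(* A conflict of [pq] passes through [q] and a neighbor other than [p]. Unless that neighbor is [y],
   it conflicts with [qy] too. *)
- move=> f _ /edge_conflict_cases[x [z [-> gxz [[gpx xq _]|[gqx xp zq]]]]] fS.
    by move: gpx; rewrite (nbrs1 dp gpq).1 (negPf xq).
  apply: conf_y => //; apply: contraNneq fS => x_eq.
  by rewrite x_eq yS // -x_eq.
- move=> f fK /edge_conflict_cases[x [z [f_eq gxz [[gqx xr zq]|[grx xq zr]]]]] fS.
    rewrite f_eq conf_y //; apply: contraNneq fS => x_eq.
    by rewrite f_eq x_eq yS // -x_eq.
  (* A conflict through [r] also conflicts with [rv], unless it starts at [v]; but then it is [vu],
     which is not in [K]. *)
  apply/orP; right; rewrite f_eq [[set r; v]]setUC.
  apply: conf_walk => //; apply: contraNneq kvu => x_eq.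
  move: gxz; rewrite x_eq gV (negPf zr) /= => /eqP z_eq.
  by rewrite /kadj -z_eq -x_eq -f_eq.
Qed.
End Leafed.

Lemma give_pos_load w v : g w v -> 0 < give w v -> load w v <= 2.
Proof.
move=> gwv; case: (give_boundP gwv) => [[->|[_ lv]|[_ lv]]|[_ lv _]|[_ lv _]] // _.
- exact: leq_trans lv _.
- by rewrite lv.
Qed.

(** A payment of 4, or two positive payments with a 2-vertex among the receivers, would keep the
    total load of [q] below 7. For two 3-vertices, a sum above 2 is one of the two excluded
    configurations. *)
Lemma give_leafed_pair p q c y r : deg p = 1 -> deg q = 4 -> [/\ p != y, p != r & y != r] ->
  [/\ g q p, g q c, g q y & g q r] ->
  (forall x, g q x = [|| x == p, x == c, x == y | x == r]) ->
  (forall F : T -> nat, \sum_(x | g q x) F x = F p + F c + F y + F r) ->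
  give q y + give q r <= 2.
Proof.
move=> dp dq [py pr yr] [gqp gqc gqy gqr] gQ sQ.
have gpq : g p q by rewrite gE.
have [_ _ l0] := leaf_nbr gpq dp; rewrite /total_load sQ l0 => S7.
have lc := load_le3 gqc; have ly := load_le3 gqy; have lr := load_le3 gqr.
have dy4 := load_ltd gqy; have dr4 := load_ltd gqr.
have no_give4 v : g q v -> load q c + load q y + load q r <= load q v + 6 ->
    deg v = 2 -> strong q v -> False.
  move=> gqv le_v dv st; have [_ lv _] := strong_load gqv dv st.
  by move: le_v S7; rewrite lv; clear; lia.
have sQ' (F : T -> nat) : \sum_(x | g q x) F x = F p + F c + F r + F y.
  by rewrite sQ addnAC.
have gQ' x : g q x = [|| x == p, x == c, x == r | x == y].
  by rewrite gQ; congr [|| _, _ | _]; rewrite orbC.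
case: (giveP gqy) => [|dy _ hy|dy _|dy _ ty|dy st]; last 1 first.
- by exfalso; apply: no_give4 st => //; move: lc lr; clear; lia.
all: case: (giveP gqr) => [|dr _ hr|dr _|dr _ tr|dr st] //.
all: try by exfalso; apply: no_give4 st => //; move: lc ly; clear; lia.
all: try by exfalso; rewrite dy in dy4; move: dr dr4 dy4 S7 lc => -> ; clear; lia.
- have ry : r != y by rewrite eq_sym.
  by have := not_two_deg2_has_strong_nbr dp dq dr dy pr py ry gqp gqc gqr gqy gQ' sQ' tr; rewrite hy.
- by have := not_two_deg2_has_strong_nbr dp dq dy dr py pr yr gqp gqc gqy gqr gQ sQ ty; rewrite hr.
- by have := not_two_deg2_two_deg2 dp dq dy dr py pr yr gqp gqc gqy gqr sQ ty; rewrite tr.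
Qed.

(** * Balance of charge at each vertex *)

Definition hdeg (x : T) : nat := \sum_(y | g x y) (1 < deg y).

(** The bound 2 is 6 * 3 - 16. The loads of the three neighbors besides the leaf add up to at least
    7, so all are positive. A paid neighbor has load at most 2, so one of the three is unpaid, and
    [give_leafed_pair] bounds the rest. *)
Lemma give_leafed p q : g q p -> deg p = 1 ->
  hdeg q = 3 /\ \sum_(x | g q x) give q x <= 2.
Proof.
move=> gqp dp; have gpq : g p q by rewrite gE.
have [dq _ l0 ] := leaf_nbr gpq dp.
have [b [c [d [[bp cp dp'] [bc bd cd] [gqb gqc gqd] gQ sQ]]]] := nbrs4 dq gqp.
rewrite /hdeg /total_load !sQ l0 dp add0n => S7.
have lb := load_le3 gqb; have lc := load_le3 gqc; have ld := load_le3 gqd.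
have pos x : g q x -> 0 < load q x -> 1 < deg x.
  by move=> /load_ltd lx x0; apply: leq_ltn_trans lx.
have g0 : give q p = 0 by rewrite /give dp.
rewrite !pos //; try by move: S7 lb lc ld; clear; lia.
split=> //; rewrite g0.
have hcd : give q c + give q d <= 2.
  by apply: (give_leafed_pair (p := p) (c := b)); rewrite // ![p == _]eq_sym.
have hbd : give q b + give q d <= 2.
  apply: (give_leafed_pair (p := p) (c := c)); rewrite // ?[p == _]eq_sym //.
    by move=> x; rewrite gQ; do 4 case: eqP => _ //=.
  by move=> F; rewrite sQ; clear; lia.
have hbc : give q b + give q c <= 2.
  apply: (give_leafed_pair (p := p) (c := d)); rewrite // ?[p == _]eq_sym //.
    by move=> x; rewrite gQ; do 4 case: eqP => _ //=.
  by move=> F; rewrite sQ; clear; lia.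
have pb := give_pos_load gqb; have pc := give_pos_load gqc; have pd := give_pos_load gqd.
move: S7 pb pc pd hcd hbd hbc lb lc ld; clear.
move: (give q b) (give q c) (give q d) => gb gc gd.
case: gb => [|gb]; first by lia.
case: gc => [|gc]; first by lia.
case: gd => [|gd]; first by lia.
by move=> S7 /(_ isT) pb /(_ isT) pc /(_ isT) pd; exfalso; lia.
Qed.

Lemma deg_gt0 x y : g x y -> 0 < deg y.
Proof. by move=> gxy; apply/card_gt0P; exists x; rewrite inE gE. Qed.

Lemma deg_sum x : deg x = \sum_(y | g x y) 1.
Proof. by rewrite sum1_card; apply: eq_card => y; rewrite inE. Qed.

Lemma hdeg_no_leaf x : (forall y, g x y -> deg y != 1) -> hdeg x = deg x.
Proof.
move=> no_leaf; rewrite deg_sum; apply: eq_bigr => y gxy.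
by rewrite ltn_neqAle eq_sym no_leaf ?(deg_gt0 gxy).
Qed.

Lemma hdeg_small x : deg x <= 3 -> hdeg x = deg x.
Proof.
move=> dx; apply: hdeg_no_leaf => y gxy; apply/eqP => dy.
by have [dx4 _ _ _] := leaf_nbr (etrans (gE y x) gxy) dy; rewrite dx4 in dx.
Qed.

(* 6 (hdeg x - 8/3) + income >= payments *)
Definition balanced (x : T) : Prop :=
  16 + \sum_(y | g x y) give x y <= 6 * hdeg x + \sum_(y | g x y) give y x.

(** A 2-vertex lacks 16 - 12 = 4 units and receives 2 + 2, or 0 + 4 if one neighbor is weak. It pays
    nothing: an edge between 2-vertices would have at most 6 conflicts, hence is not in [K], which
    makes [v] weak for a neighbor of degree 2. *)
Lemma balanced2 v : deg v = 2 -> balanced v.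
Proof.
move=> dv; have [w gvw] : exists w, g v w by apply: deg_gt0_nbr; rewrite dv.
have [u [uw gvu gV sV]] := nbrs2 dv gvw.
have gwv : g w v by rewrite gE.
have guv : g u v by rewrite gE.
have wu : w != u by rewrite eq_sym.
have kd := kdeg_sum Kg v; rewrite sV in kd.
rewrite /balanced hdeg_small ?dv // !sV.
have out0 a b : g v a -> kdeg v = kadj v a + kadj v b ->
    total_load v = load v a + load v b -> g v b -> give v a = 0.
  move=> gva kv Sv gvb; rewrite /give dv andbF.
  case: eqP => // da; suff -> : weak v a by [].
  have gav : g a v by rewrite gE.
  have nk : ~~ kadj a v.
    apply/negP => kav; have := load7 kav; have [c [_ gac _ sA]] := nbrs2 da gav.
    have := load_le3 gac; have := load_le3 gvb.
    by rewrite Sv /total_load sA; clear; lia.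
  by rewrite /weak nk kv kadj_sym (negPf nk); case: (kadj v b).
have in4 : give w v + give u v = 4.
  have k0 := kdeg_gt0 gvw; rewrite /give dv eqxx /=.
  (* Since [v] meets [K], its two neighbors cannot both be weak. *)
  have nw a b : weak a v -> kdeg v = kadj v a + kadj v b -> g v a -> g v b -> a != b ->
     (weak b v = false) * (strong b v = true).
    move=> wa kv gva gvb ab; have /andP[nka _] := wa; split.
      by apply/negbTE/negP => /andP[nkb _]; move: k0; rewrite kv (negPf nka) (negPf nkb).
    by apply/existsP; exists a; rewrite gva ab.
  have [ww|nww] := boolP (weak w v).
    by have [-> ->] := nw _ _ ww kd gvw gvu wu.
  have [wku|nwu] := boolP (weak u v).
    by have [_ ->] := nw _ _ wku (etrans kd (addnC _ _)) gvu gvw uw.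
  have ns b a : (forall x, g v x = (x == a) || (x == b)) \/
      (forall x, g v x = (x == b) || (x == a)) ->
      ~~ weak a v -> strong b v = false.
    move=> gV' na; apply/negbTE/existsP => -[c /and3P[gvc cb wc]].
    by move: gvc; case: gV' => ->; rewrite (negPf cb) ?orbF => /eqP c_eq;
      rewrite c_eq (negPf na) in wc.
  by rewrite (ns w u) ?(ns u w); auto.
have Sv : total_load v = load v w + load v u by rewrite /total_load sV.
rewrite in4 (out0 w u) // (out0 u w) //; first by rewrite kd addnC.
by rewrite Sv addnC.
Qed.

(** A 3-vertex has 18 - 16 = 2 units of its own. If it pays 4 to a neighbor, the other two have load
    3, hence degree 4, and return 1 each. If it pays 2 twice, a tight count makes the third neighbor
    a 4-vertex, which returns 2. *)
Lemma balanced3 y : deg y = 3 -> balanced y.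
Proof.
move=> dy; rewrite /balanced hdeg_small ?dy //.
have [hs|nhs] := boolP (has_strong_nbr y).
  have [x gyx gx4] := has_strong_nbrP y hs.
  have [dx kyx lx S6 _] := give4 gyx gx4.
  have [a gya xa] := nbrs3_ex dy gyx.
  have [b [bx ba gyb gY sY]] := nbrs3 dy gyx gya xa.
  have la := load_le3 gya; have lb := load_le3 gyb.
  move: S6; rewrite /total_load sY lx => S6.
  have d4 z : g y z -> 3 <= load y z -> give y z = 0 /\ give z y = 1.
    move=> gyz lz; have dz : deg z = 4.
      by have := load_ltd gyz; have := deg_le4 z; move: lz; clear; lia.
    by rewrite /give dz dy /= hs.
  have [g0a ga] : give y a = 0 /\ give a y = 1 by apply: d4 => //; move: S6 lb; clear; lia.
  have [g0 gb] : give y b = 0 /\ give b y = 1 by apply: d4 => //; move: S6 la; clear; lia.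
  by rewrite !sY gx4 g0a g0 ga gb; clear; lia.
have le2 x : g y x -> give y x = 0 \/ [/\ give y x = 2, deg x = 2 & weak y x = false].
  move=> gyx; case: (giveP gyx) => [|_|d wk|_|d st]; rewrite ?dy //; [by left | by right |].
  by case/negP: nhs; apply/existsP; exists x; rewrite gyx d st.
have two a b : g y a -> g y b -> a != b -> give y a = 2 -> give y b = 2 ->
    16 + \sum_(x | g y x) give y x <= 18 + \sum_(x | g y x) give x y.
  move=> gya gyb ab ga gb.
  have [|[_ da wa]] := le2 a gya; first by rewrite ga.
  have [|[_ db wb]] := le2 b gyb; first by rewrite gb.
  have [c [ca cb gyc gY sY]] := nbrs3 dy gya gyb ab.
  have kd := kdeg_sum Kg y; rewrite sY in kd.
  (* If [kdeg y] were at most 1, then [y] being weak for neither [a] nor [b] would put both [ya] and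
     [yb] in [K]. *)
  have k2 : 2 <= kdeg y.
    rewrite leqNgt; apply/negP => k1; move: wa wb.
    rewrite /weak -ltnS k1 !andbT ![kadj _ y]kadj_sym.
    by move=> /negbFE ka /negbFE kb; move: k1; rewrite kd ka kb; case: (kadj y c).
  have far v v' : g y v -> g y v' -> deg v = 2 -> deg v' = 2 -> kadj y v ->
      (forall F : T -> nat, \sum_(x | g y x) F x = F v + F v' + F c) -> deg c = 4.
    move=> gyv gyv' dv dv' kyv sY'; have := load7 kyv.
    have gvy : g v y by rewrite gE.
    have [u [_ gvu _ sV]] := nbrs2 dv gvy.
    have := load_le3 gvu; have := load_ltd gyv'; have := load_ltd gyc; have := deg_le4 c.
    by rewrite dv' /total_load sY' sV; clear; lia.
  have dc : deg c = 4.
    have [kya|nka] := boolP (kadj y a); first exact: (far a b).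
    have [kyb|nkb] := boolP (kadj y b).
      by apply: (far b a) => // F; rewrite sY [F b + _]addnC.
    by move: k2; rewrite kd (negPf nka) (negPf nkb); case: (kadj y c).
  have td : has_two_deg2 y by rewrite /has_two_deg2 k2 sY da db dc.
  rewrite !sY ga gb.
  have -> : give y c = 0 by rewrite /give dc.
  have -> : give c y = 2 by rewrite /give dy dc /= (negPf nhs) td.
  by clear; lia.
have [a gya] : exists a, g y a by apply: deg_gt0_nbr; rewrite dy.
have [b gyb ab] := nbrs3_ex dy gya.
have [c [ca cb gyc gY sY]] := nbrs3 dy gya gyb ab.
have Ha := le2 a gya; have Hb := le2 b gyb; have Hc := le2 c gyc.
case: Ha => [a0|[a2 _ _]]; case: Hb => [b0|[b2 _ _]]; case: Hc => [c0|[c2 _ _]];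
  try by rewrite sY ?a0 ?a2 ?b0 ?b2 ?c0 ?c2; clear; lia.
- by apply: (two b c) => //; rewrite eq_sym.
- by apply: (two a c) => //; rewrite eq_sym.
- exact: (two a b).
- exact: (two a b).
Qed.

(** The payments fit in the initial charge: 6 * 3 - 16 = 2 next to a leaf, 6 * 4 - 16 = 8
    otherwise. *)
Lemma balanced4 q : deg q = 4 -> balanced q.
Proof.
move=> dq; apply: leq_trans (leq_addr _ _).
have [/existsP[p /andP[gqp /eqP dp]]|no_leaf] := boolP [exists p, g q p && (deg p == 1)].
  by have [-> out] := give_leafed gqp dp; move: out; clear; lia.
have nl x : g q x -> deg x != 1.
  by move=> gqx; apply: contra no_leaf => dx; apply/existsP; exists x; rewrite gqx dx.
rewrite hdeg_no_leaf // dq (_ : 6 * 4 = 16 + 8) // leq_add2l; exact: give_deg4.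
Qed.

(** This lets sums of payments over the vertices of degree at least 2 be extended to all vertices.
    The neighbor of a paying leaf would have degree 4, and such a vertex receives nothing. *)
Lemma give_eq0 w v : g w v -> ~~ ((1 < deg w) && (1 < deg v)) -> give w v = 0.
Proof.
move=> gwv; have := deg_gt0 gwv; rewrite /give; case dv: (deg v) => [|[|d]] // _.
rewrite andbT => dw; have dw1 : deg w = 1.
  by have := @deg_gt0 v w; rewrite gE => /(_ gwv); case: (deg w) dw => [|[]].
by have [dv4 _ _ _] := leaf_nbr gwv dw1; move: dv; rewrite dv4 => -[<-].
Qed.

(** When the balances are summed, the total paid and the total received are equal and cancel. *)
Lemma hdeg_average : 8 * #|[set x | 1 < deg x]| <= 3 * \sum_(x | 1 < deg x) hdeg x.
Proof.
have bal x : 1 < deg x -> balanced x.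
  case dx: (deg x) (deg_le4 x) => [|[|[|[|[|]]]]] // _ _.
  - exact: balanced2.
  - exact: balanced3.
  - exact: balanced4.
have out_sum : \sum_(x | 1 < deg x) \sum_(y | g x y) give x y = \sum_x \sum_(y | g x y) give x y.
  rewrite [LHS]big_mkcond; apply: eq_bigr => x _; case: ifP => // dx.
  by rewrite big1 // => y gxy; rewrite give_eq0 // dx.
have in_sum : \sum_(x | 1 < deg x) \sum_(y | g x y) give y x = \sum_x \sum_(y | g x y) give x y.
  rewrite [RHS](exchange_big_dep predT) //= [LHS]big_mkcond; apply: eq_bigr => x _.
  under [RHS]eq_bigl do rewrite gE.
  case: ifP => // dx; rewrite big1 // => y gxy; rewrite give_eq0 //; first by rewrite gE.
  by rewrite dx andbF.
have : \sum_(x | 1 < deg x) (16 + \sum_(y | g x y) give x y) <=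
       \sum_(x | 1 < deg x) (6 * hdeg x + \sum_(y | g x y) give y x).
  by apply: leq_sum => x; apply: bal.
rewrite [leqLHS]big_split [leqRHS]big_split out_sum in_sum leq_add2r sum_nat_const.
have -> : \sum_(x | 1 < deg x) 6 * hdeg x = 6 * \sum_(x | 1 < deg x) hdeg x.
  by rewrite big_distrr.
rewrite (_ : #|[set x | 1 < deg x]| = #|[pred x | 1 < deg x]|); last first.
  by apply: eq_card => x; rewrite !inE.
move: (\sum_(x | _) hdeg x) #|[pred x | _]| => a b.
by clear; lia.
Qed.

Lemma core_nonempty x y : g x y -> exists z, 1 < deg z.
Proof.
move=> gxy; have [d1|d1] := eqVneq (deg x) 1; last first.
  exists x; move: (@deg_gt0 y x); rewrite gE gxy => /(_ isT).
  by rewrite leq_eqVlt eq_sym (negPf d1).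
by exists y; have [-> _ _ _] := leaf_nbr gxy d1.
Qed.

End Discharging.

(** * The maximum average degree *)

Lemma proper_eq (E : finType) (r r' : rel E) n (A : {set E}) (c : {ffun E -> 'I_n}) :
  {in A &, r =2 r'} -> proper_coloring r A c = proper_coloring r' A c.
Proof.
move=> rr'; apply: eq_forallb_in => e eA; apply: eq_forallb_in => f fA.
by rewrite rr'.
Qed.

Lemma critical_eq (E : finType) (r r' : rel E) n (K : {set E}) :
  {in K &, r =2 r'} -> critical r n K -> critical r' n K.
Proof.
move=> rr' /minsetP[nK minK].
have col_eq (A : {set E}) : A \subset K -> colorable r n A = colorable r' n A.
  move=> AK; apply: eq_existsb => c; apply: proper_eq => e f eA fA.
  by apply: rr'; apply: (subsetP AK).
apply/minsetP; split=> [|B nB BK]; first by rewrite -col_eq.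
by apply: minK => //; rewrite col_eq.
Qed.

(** * From injective colorings to the conflict relation *)

Section Graph.
Variable G : sgraph.
Implicit Types (x y z : G) (e f : {set G}).

Lemma edgesP e : reflect (exists x y, e = [set x; y] /\ adj x y) (e \in edges G).
Proof.
apply: (iffP imsetP) => [[[x y] xy ->]|[x [y [-> xy]]]].
  by exists x, y; split=> //; rewrite inE in xy.
by exists (x, y); rewrite // inE.
Qed.

Lemma edge_adj x y : [set x; y] \in edges G -> adj x y.
Proof.
by case/edgesP => a [b [/set2_inj[] [-> ->]]] //; rewrite (@adj_sym G).
Qed.

Lemma distance_two_conflict e f : e \in edges G -> f \in edges G ->
  distance_two e f -> edge_conflict (@adj G) e f.
Proof.
case/edgesP => a [u [-> au]] /edgesP[x [z [-> xz]]] /and3P[_ dis].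
case/existsP => h /andP[hE /andP[]].
have meet (A B : {set G}) : ~~ [disjoint A & B] -> exists2 t, t \in A & t \in B.
  by rewrite -setI_eq0 => /set0Pn[t]; rewrite inE => /andP[]; exists t.
move=> /meet[s sh se] /meet[t th tf].
have st : s != t by apply: contraTneq dis => eq_st; apply/pred0Pn; exists s; rewrite /= se eq_st.
have ast : adj s t.
  case/edgesP: hE => i [j [h_eq ij]]; move: sh th st; rewrite h_eq.
  by move=> /set2P[]-> /set2P[]->; rewrite ?eqxx // (@adj_sym G).
have [s' [e_eq s's]] : exists s', [set a; u] = [set s'; s] /\ adj s' s.
  by case/set2P: se => ->; [exists u; rewrite setUC (@adj_sym G) | exists a].
have [t' [f_eq tt']] : exists t', [set x; z] = [set t; t'] /\ adj t t'.
  by case/set2P: tf => ->; [exists z | exists x; rewrite setUC (@adj_sym G)].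
rewrite e_eq f_eq in dis *; apply: edge_conflict_walk => //.
  by apply: contraTneq dis => <-; apply/pred0Pn; exists t; rewrite /= !inE eqxx ?orbT.
by apply: contraTneq dis => ->; apply/pred0Pn; exists s; rewrite /= !inE eqxx ?orbT.
Qed.

Lemma in_common_triangle_conflict e f : e \in edges G -> f \in edges G ->
  in_common_triangle e f -> edge_conflict (@adj G) e f.
Proof.
case/edgesP => a [u [-> au]] /edgesP[x [z [-> xz]]] /andP[ef /existsP[W]].
case/and3P => /andP[/eqP W3 /forall_inP tri] eW fW.
have irr (s t : G) : adj s t -> s != t.
  by move=> st; apply: contraTneq st => ->; rewrite (@adj_irrefl G).
have triW (s t : G) : s \in W -> t \in W -> s != t -> adj s t.
  by move=> sW tW st; have /forall_inP/(_ t tW)/implyP := tri s sW; apply.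
have inW (A : {set G}) s : A \subset W -> s \in A -> s \in W by move=> AW; apply: (subsetP AW).
have aW := inW _ _ eW (set21 a u); have uW := inW _ _ eW (set22 a u).
have xW := inW _ _ fW (set21 x z); have zW := inW _ _ fW (set22 x z).
have key (s b c d : G) : [set a; u] = [set s; b] -> [set x; z] = [set d; c] ->
    adj s b -> adj d c -> s = c -> edge_conflict (@adj G) [set a; u] [set x; z].
  move=> e_eq f_eq sb dc sc; rewrite e_eq f_eq; subst c.
  have bd : b != d by apply: contraNneq ef => bd; rewrite e_eq f_eq bd setUC.
  have bW : b \in W by apply: (inW _ _ eW); rewrite e_eq set22.
  have dW : d \in W by apply: (inW _ _ fW); rewrite f_eq set21.
  apply: edge_conflict_walk => //; first exact: triW.
    exact: irr.
  exact: irr.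
have e_eq : [set a; u] = [set u; a] by rewrite setUC.
have f_eq : [set x; z] = [set z; x] by rewrite setUC.
have ua : adj u a by rewrite (@adj_sym G).
have zx : adj z x by rewrite (@adj_sym G).
have [az|az] := eqVneq a z; first exact: (key a u z x).
have [ax|ax] := eqVneq a x; first exact: (key a u x z).
have [uz|uz] := eqVneq u z; first exact: (key u a z x).
have [ux|ux] := eqVneq u x; first exact: (key u a x z).
(* Disjoint edges would put four vertices in the triangle [W]. *)
have sub : [set a; u; x; z] \subset W by rewrite !subUset !sub1set aW uW xW zW.
have := subset_leq_card sub; rewrite W3 -!setUA !cardsU1 !inE !cards1 !negb_or.
by rewrite (irr _ _ au) (irr _ _ xz) az ax uz ux.
Qed.

Lemma index_le_of_colorable n : colorable (edge_conflict (@adj G)) n (edges G) ->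
  injective_chromatic_index G <= n.
Proof.
case/existsP => c /proper_coloringP cP.
have icP : injectively_edge_colorable G n.
  apply/existsP; exists [ffun e : edge G => c (val e)].
  apply/forallP => e; apply/forallP => f; apply/implyP => ef; rewrite !ffunE.
  apply: cP; [exact: valP | exact: valP |].
  by case/orP: ef; [apply: distance_two_conflict | apply: in_common_triangle_conflict]; apply: valP.
by rewrite /injective_chromatic_index; case: ex_minnP => m _; apply.
Qed.

Lemma mad_ge (H : {set G} * {set {set G}}) : nonempty_subgraph H ->
  ((2 * #|H.2|)%:R / #|H.1|%:R <= mad G :> rat)%R.
Proof. exact: Order.TotalTheory.le_bigmax_cond. Qed.


(** * The subgraph spanned by a critical set of edges *)

Section Restriction.
Variable K : {set {set G}}.
Hypotheses (K_edges : K \subset edges G) (K_crit : critical (edge_conflict (@adj G)) 7 K).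

Definition support_adj : rel G := fun x y => [&& x \in cover K, y \in cover K & adj x y].
Local Notation g := support_adj.

Lemma support_adj_sym : symmetric g.
Proof. by move=> x y; rewrite /g (@adj_sym G) andbCA. Qed.

Lemma support_adj_irr : irreflexive g.
Proof. by move=> x; rewrite /g (@adj_irrefl G) !andbF. Qed.

Lemma mem_cover e x : e \in K -> x \in e -> x \in cover K.
Proof. by move=> eK xe; apply/bigcupP; exists e. Qed.

Lemma critical_support_adj x y : [set x; y] \in K -> g x y.
Proof.
move=> xyK; rewrite /g (edge_adj (subsetP K_edges _ xyK)).
by rewrite !(mem_cover xyK) ?inE ?eqxx ?orbT.
Qed.

Lemma support_adj_cover x y : g x y -> exists z, kadj K x z.
Proof.
case/and3P => /bigcupP[e eK xe] _ _; move: (eK) xe.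
case/edgesP: (subsetP K_edges _ eK) => a [b [-> _]] abK /set2P[]->.
  by exists b.
by exists a; rewrite /kadj setUC.
Qed.

(** The walk behind a conflict of two edges of [K] visits only their endpoints, all covered by [K],
    so restricting the graph keeps the conflicts inside [K]. *)
Lemma critical_support : critical (edge_conflict g) 7 K.
Proof.
apply: critical_eq K_crit => e f eK fK; apply/edge_conflictP/edge_conflictP.
all: move=> [a [u [x [z [e_eq f_eq [ga gu gx] xa zu]]]]]; exists a, u, x, z; split=> //.
  have inK := mem_cover eK; have inK' := mem_cover fK; rewrite e_eq f_eq in inK inK'.
  by rewrite /g ga gu gx (inK a) ?(inK u) ?(inK' x) ?(inK' z) ?inE ?eqxx ?orbT.
by case/and3P: ga => _ _ ->; case/and3P: gu => _ _ ->; case/and3P: gx => _ _ ->.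
Qed.

Lemma support_deg x : deg g x <= max_degree G.
Proof.
apply: leq_trans (leq_bigmax x); apply/subset_leq_card/subsetP => y.
by rewrite !inE => /and3P[].
Qed.

Definition big_edges : {set {set G}} :=
  [set [set p.1; p.2] | p : G * G & [&& g p.1 p.2, 1 < deg g p.1 & 1 < deg g p.2]].

Lemma big_edgesP e : reflect
  (exists x y, [/\ e = [set x; y], g x y, 1 < deg g x & 1 < deg g y]) (e \in big_edges).
Proof.
apply: (iffP imsetP) => [[[x y]]|[x [y [-> xy dx dy]]]].
  by rewrite inE => /and3P[xy dx dy] ->; exists x, y.
by exists (x, y); rewrite // inE /= xy dx.
Qed.

Lemma big_edges_handshake : \sum_(x | 1 < deg g x) hdeg g x <= 2 * #|big_edges|.
Proof.
apply: leq_trans (_ : \sum_x \sum_(e in big_edges) (x \in e) <= _).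
  rewrite [leqLHS]big_mkcond; apply: leq_sum => x _; case: ifP => // dx.
  rewrite /hdeg -big_mkcondr sum1_card -big_mkcondr sum1_card.
  have injx : {in [pred y | g x y & 1 < deg g y] &, injective (fun y => [set x; y])}.
    by move=> y z _ _ /set2_inj[[_ ->]|[-> ->]].
  rewrite -(card_in_imset injx); apply/subset_leq_card/subsetP => e.
  case/imsetP => y; rewrite !inE => /andP[xy dy] ->; rewrite unfold_in /= set21 andbT.
  by apply/big_edgesP; exists x, y.
rewrite exchange_big /= mulnC -sum_nat_const; apply: leq_sum => e /big_edgesP[x [y [-> _ _ _]]].
by rewrite -big_mkcond sum1_card cards2; case: (x != y).
Qed.

(** The subgraph that witnesses the bound consists of the vertices of degree at least 2 in
    [support_adj] and of [big_edges]. *)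
Lemma critical_mad : max_degree G <= 4 -> (8%:R / 3%:R <= mad G :> rat)%R.
Proof.
move=> D4; have deg4 x : deg g x <= 4 := leq_trans (support_deg x) D4.
have avg := hdeg_average support_adj_sym support_adj_irr critical_support_adj critical_support
  deg4 support_adj_cover.
(* The empty set of edges is colorable, so [K] is not empty. *)
have [e eK] : exists e, e \in K.
  apply/set0Pn; apply: contra (minsetp K_crit) => /eqP->.
  by apply/existsP; exists [ffun=> ord0]; apply/proper_coloringP => e; rewrite inE.
have [x [y [e_eq _]]] := edgesP _ (subsetP K_edges _ eK).
rewrite e_eq in eK; have gxy := critical_support_adj eK.
have [z dz] := core_nonempty support_adj_sym support_adj_irr critical_support_adj critical_support
  deg4 support_adj_cover gxy.
pose H := [set x | 1 < deg g x].
have Hpos : 0 < #|H| by apply/card_gt0P; exists z; rewrite inE.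
have sub : nonempty_subgraph (H, big_edges).
  apply/and3P; split=> /=; first by rewrite -card_gt0.
    apply/subsetP => f /big_edgesP[a [b [-> /and3P[_ _ ab] _ _]]].
    by apply/edgesP; exists a, b.
  apply/forall_inP => f /big_edgesP[a [b [-> _ da db]]].
  by apply/subsetP => t /set2P[]->; rewrite inE.
apply: Order.POrderTheory.le_trans (mad_ge sub).
rewrite /= Num.Theory.ler_pdivlMr ?Num.Theory.ltr0n // GRing.mulrAC.
rewrite Num.Theory.ler_pdivrMr ?Num.Theory.ltr0n //.
rewrite -!GRing.natrM Num.Theory.ler_nat.
rewrite [leqRHS]mulnC.
exact: leq_trans avg (leq_mul (leqnn 3) big_edges_handshake).
Qed.
End Restriction.
End Graph.

Theorem theorem1p1 (G : sgraph) (hDelta : max_degree G <= 4)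
  (hmad : (mad G < 8%:R / 3%:R)%R) :
  injective_chromatic_index G <= 7.
Proof.
apply: index_le_of_colorable; apply: contraT => not_col.
have [K K_crit K_edges] :=
  @minset_exists _ (fun A => ~~ colorable (edge_conflict (@adj G)) 7 A) _ not_col.
have := critical_mad K_edges K_crit hDelta.
by rewrite Order.TotalTheory.leNgt hmad.
Qed.
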